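(* Let $d\ge 2$, $m\ge 1$, $L\ge 1$ and $H\ge 1$ be integers and $C>0$ a real number. Let $t_1,\dots,t_m$ be independent real random variables, let $a_0$ be an integer-valued random variable independent of $(t_1,\dots,t_m)$, and let $f(x)=x^d+a_{d-1}x^{d-1}+\dots+a_1x+a_0\in\mathbb{Z}[x]$. Assume that for some $0<k<d$ coprime to $d$ we have $$a_k=F_2(a_0,t_1,\dots,t_m),\qquad (a_j)_{1\le j\le d-1,\,j\ne k}=F_1(a_0,t_1,\dots,t_{m-1}),$$ where $F_2:\mathbb{R}^{m+1}\to\mathbb{R}$ and $F_1:\mathbb{R}^{m}\to\mathbb{R}^{d-2}$ are polynomials of degree at most $L$, and $F_2$ has positive degree in $t_m$ for any fixed nonzero value of $a_0$. Assume that each $t_i$ is distributed according to a $(C,2^dL)$-uniform distribution over a finite set $H_i$ of size at least $H$. Then $$\mathbb{P}(f(x)\text{ is irreducible over }\mathbb{Z})\ \ge\ 1-\mathbb{P}(a_0=0)-\frac{2Cdm2^dL\,\mathbb{E}[\tau(a_0)I(a_0\ne 0)]}{H}.$$ In particular: (1) For every nonzero polynomial $P\in\mathbb{Z}[x]$ there is a constant $C(P)$ depending only on $P$ such that, if $H\ge 3$ and $a_0$ is distributed uniformly on the values $\{P(n):-H\le n\le H\}$ ($n$ ranging over integers), then $$\mathbb{P}(f(x)\text{ is irreducible over }\mathbb{Z})\ \ge\ 1-\frac{\deg(P)}{2H+1}-\frac{2Cmd2^dL(\log H)^{C(P)}}{H}.$$ (2) If $a_0$ is supported on $s$-simple integers,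 then $$\mathbb{P}(f(x)\text{ is irreducible over }\mathbb{Z})\ \ge\ 1-\frac{2Cmd2^dLs}{H}.$$
   Context: For a nonzero integer $n$, $\tau(n)$ denotes the number of positive divisors of $n$. $I(\cdot)$ denotes the indicator function of an event. If the expectation is infinite, the bound is vacuous. A positive integer $n$ is called $s$-simple if $\tau(n)\le s$. A distribution $D$ supported on a finite subset of $\mathbb{C}$ of size $k$ is called $(C,t)$-uniform if for any subset $T$ of $\mathbb{C}$ of size at most $t$, $D(T)\le \frac{C|T|}{k}$. (For $t_i$ distributed over $H_i$, the size is $k=|H_i|$.) ''$F_2$ has positive degree in $t_m$ for any fixed nonzero value of $a_0$'' means: for every nonzero integer $c$, the polynomial $F_2(c,t_1,\dots,t_m)$ in the variables $t_1,\dots,t_m$ has positive degree in $t_m$. A monic integer polynomial of positive degree is irreducible over $\mathbb{Z}$ if it is not a product of two polynomials in $\mathbb{Z}[x]$ of positive degree. *)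

(* Defs.v *)
From HB Require Import structures.
From mathcomp Require Import all_boot all_order all_algebra finmap.
From mathcomp Require Import all_classical all_reals all_analysis.
(* The notations of mpoly clash with those of mathcomp-analysis. *)
From mathcomp Require Import -(notations) mpoly.

Set Implicit Arguments.
Unset Strict Implicit.
Unset Printing Implicit Defensive.

Import Order.TTheory GRing.Theory Num.Theory.
Import numFieldNormedType.Exports.

Local Open Scope classical_set_scope.
Local Open Scope ring_scope.

HB.instance Definition _ := isPointed.Build int 0.

HB.instance Definition _ := @isMeasurable.Build default_measure_display
  int (@discrete_measurable int) (@discrete_measurable0 int)
  (@discrete_measurableC int) (@discrete_measurableU int).

(* Junk value at 0; every use below is guarded by n != 0 or 0 < n. *)
Definition tau (n : int) : nat := size (divisors `|n|%N).

Definition simple (s : nat) (n : int) : Prop := 0 < n /\ (tau n <= s)%N.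

Definition irreducibleZ (p : {poly int}) : Prop :=
  (1 < size p)%N /\
  forall q r : {poly int}, (1 < size q)%N -> (1 < size r)%N -> p <> q * r.

Section Probability.
Local Open Scope ereal_scope.

Definition independent2 (R : realType) (d d1 d2 : measure_display)
    (T : measurableType d) (T1 : measurableType d1) (T2 : measurableType d2)
    (Pr : probability T R) (X : T -> T1) (Y : T -> T2) : Prop :=
  forall (A : set T1) (B : set T2), measurable A -> measurable B ->
    Pr (X @^-1` A `&` Y @^-1` B) = Pr (X @^-1` A) * Pr (Y @^-1` B).

Definition mutually_independent (R : realType) (d d1 : measure_display)
    (T : measurableType d) (T1 : measurableType d1) (Pr : probability T R)
    (m : nat) (X : 'I_m -> T -> T1) : Prop :=
  forall (J : {set 'I_m}) (B : 'I_m -> set T1),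
    (forall i, i \in J -> measurable (B i)) ->
    Pr (\bigcap_(i in [set` J]) (X i @^-1` B i)) =
    \prod_(i in J) Pr (X i @^-1` B i).

(* D is a (C, n)-uniform distribution over the finite set S. The carrier K is *)
(* arbitrary; it is used for real random variables, where the finite subsets  *)
(* of the complex plane need only be tested through their real points.        *)
Definition cuniform (R : realType) (K : choiceType) (D : set K -> \bar R)
    (S : {fset K}) (C : R) (n : nat) : Prop :=
  D [set` S] = 1 /\
  forall A : {fset K}, (#|` A| <= n)%N ->
    D [set` A] <= (C * #|` A|%:R / #|` S|%:R)%:E.

(* Each entry of s is drawn with probability 1 / size s, so that a value is   *)
(* weighted by its multiplicity in s.                                         *)
Definition uniform_on (R : realType) (K : eqType) (D : set K -> \bar R)
    (s : seq K) : Prop :=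
  forall v : K, D [set v] = ((count_mem v s)%:R / (size s)%:R)%:E.

End Probability.

(* P(-H), ..., P(H), with repetitions when P takes a value several times. *)
Definition values (P : {poly int}) (H : nat) : seq int :=
  [seq P.[n%:Z - H%:Z] | n <- iota 0 (2 * H).+1].

Section Polynomials.
Variable R : nzRingType.

(* In m.+1 variables, variable 0 is a_0 and variable i is t_i (1 <= i <= m).  *)
Definition cons_arg (A : Type) (m : nat) (x0 : A) (x : 'I_m -> A)
    (i : 'I_m.+1) : A :=
  if unlift ord0 i is Some j then x j else x0.

(* F(c, t_1, ..., t_m) as a polynomial in t_1, ..., t_m. *)
Definition fix_first (m : nat) (c : R) (F : mpoly m.+1 R) :
    mpoly m R :=
  comp_mpoly
    [tuple cons_arg (mpolyC m c)
       (fun j : 'I_m => mpolyX R (mnm1 j)) i | i < m.+1] F.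

Definition degree_in (m : nat) (i : 'I_m) (F : mpoly m R) : nat :=
  \max_(mon <- msupp F) (mon : multinom m) i.

Definition degree_le (m : nat) (L : nat) (F : mpoly m R) : Prop :=
  (msize F <= L.+1)%N.

End Polynomials.

(* Only a 0, ..., a d.-1 are used. *)
Definition monic_of (d : nat) (a : nat -> int) : {poly int} :=
  'X^d + \poly_(j < d) a j.

(* t i, for i < m, is the variable t_{i+1}; a j is the random coefficient of  *)
(* x^j, tied to the t's almost surely, as a sure equality would also          *)
(* constrain the null event where some t i falls outside its finite set.      *)
Record random_poly (R : realType) (d m L H : nat) (C : R)
    (disp : measure_display) (Omega : measurableType disp)
    (Pr : probability Omega R)
    (t : 'I_m -> {RV Pr >-> R}) (a : nat -> {RV Pr >-> int}) : Prop := {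
  rp_d : (2 <= d)%N;
  rp_m : (1 <= m)%N;
  rp_L : (1 <= L)%N;
  rp_H : (1 <= H)%N;
  rp_C : 0 < C;
  rp_indep : mutually_independent Pr (fun i => t i : Omega -> R);
  rp_indep0 : independent2 Pr (a 0%N : Omega -> int)
    ((fun w => [tuple t i w | i < m]) : Omega -> m.-tuple R);
  rp_unif : forall i : 'I_m, exists Hi : {fset R},
    (H <= #|` Hi|)%N /\ cuniform (distribution Pr (t i)) Hi C (2 ^ d * L);
  rp_coef : exists (k : nat) (F2 : mpoly m.+1 R)
                   (F1 : nat -> mpoly m R),
    [/\ (0 < k < d)%N /\ coprime k d,
        degree_le L F2 /\
        (forall j, (0 < j < d)%N -> j != k -> degree_le L (F1 j)),
        forall c : int, c != 0 -> forall i : 'I_m, i.+1 = m ->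
          (0 < degree_in i (fix_first c%:~R F2))%N,
        {ae Pr, forall w, (a k w)%:~R =
          meval (cons_arg (a 0%N w)%:~R (fun i => t i w)) F2} &
        forall j, (0 < j < d)%N -> j != k ->
          {ae Pr, forall w, (a j w)%:~R =
            meval (fun i : 'I_m => cons_arg (a 0%N w)%:~R
              (fun i => t i w) (widen_ord (leqnSn m) i)) (F1 j)}]
}.

(* Main.v *)
Require Import Defs.
From mathcomp Require Import all_boot all_order all_algebra finmap.
From mathcomp Require Import all_fingroup all_field.
From mathcomp Require Import all_classical all_reals all_analysis measurable_realfun.
From mathcomp Require Import -(notations) mpoly.
From mathcomp Require ssrcomplements.
From mathcomp Require Import zify ring lra.
Import Order.TTheory GRing.Theory Num.Theory.
Import numFieldNormedType.Exports.

(* Freeze a_0 = c <> 0 and every coefficient except T = a_k, and let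
   alpha_1, ..., alpha_d be the complex roots of the polynomial. If it has a
   monic factor q with q(0) = b, then b divides c and b is the product of
   -alpha_i over some proper nonempty subset S of the roots. The product Phi(T)
   over all such S of b - prod_(i in S) -alpha_i is symmetric in the roots, of
   degree at most 2^d in each of them, hence a polynomial in T of degree at most
   2^d. It is not zero: as T tends to infinity every root has size about
   T^(-1/k) or T^(1/(d-k)), so a product over i roots of the first kind and j
   of the second has size about T^(j/(d-k) - i/k), and the exponent vanishes
   only if d divides i + j = |S|. So each of the 2 tau(c) values of b excludes
   at most 2^d values of T, hence at most 2^d L values of t_m as soon as F_2 is
   not constant in t_m, which fails for few (t_1, ..., t_(m-1)) by
   Schwartz-Zippel. Summing over c gives the general bound.

   For a_0 uniform on the values of P it remains to bound the mean of tau(P(n))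
   by a power of log H. One may take P coprime to P' (otherwise split P
   and use tau(x y)^l <= tau(x)^(2l) + tau(y)^(2l)). Then P has at most tau(m)^B
   roots modulo m, and tau(P(n)) <= 2^k tau(e)^(k+1) for some divisor e <= H of
   P(n), so the mean is bounded by sums of tau(e)^A / e over e <= H, hence by
   the (2^A)-th power of the harmonic sum. *)

Local Open Scope ring_scope.
Set Implicit Arguments.
Unset Strict Implicit.
Unset Printing Implicit Defensive.

(** * Symmetric polynomials with bounded partial degree *)

Section SymmetricPolynomials.

Lemma degree_in_leP (R : nzRingType) (n : nat) (i : 'I_n) (p : mpoly n R) (D : nat) :
  reflect (forall m, m \in msupp p -> (m i <= D)%N) (degree_in i p <= D)%N.
Proof.
apply: (iffP idP) => [le_D m m_p|le_D].
  apply: leq_trans le_D; rewrite /degree_in.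
  exact: (@leq_bigmax_seq _ _ _ (fun m : multinom n => m i) m m_p).
by apply/bigmax_leqP_seq => m m_p _; apply: le_D.
Qed.

Lemma degree_inD_le (R : nzRingType) (n : nat) (i : 'I_n) (p q : mpoly n R) (D : nat) :
  (degree_in i p <= D)%N -> (degree_in i q <= D)%N -> (degree_in i (p + q)%R <= D)%N.
Proof.
move=> /degree_in_leP hp /degree_in_leP hq; apply/degree_in_leP => m /msuppD_le.
by rewrite mem_cat => /orP[/hp|/hq].
Qed.

Lemma degree_inZ_le (R : nzRingType) (n : nat) (i : 'I_n) (c : R) (p : mpoly n R) (D : nat) :
  (degree_in i p <= D)%N -> (degree_in i (c *: p)%R <= D)%N.
Proof. by move=> /degree_in_leP hp; apply/degree_in_leP => m /msuppZ_le /hp. Qed.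

Lemma degree_inM_le (R : nzRingType) (n : nat) (i : 'I_n) (p q : mpoly n R) (D E : nat) :
  (degree_in i p <= D)%N -> (degree_in i q <= E)%N ->
  (degree_in i (p * q)%R <= D + E)%N.
Proof.
move=> /degree_in_leP hp /degree_in_leP hq; apply/degree_in_leP => m.
move=> /msuppM_le /allpairsP[[m1 m2] /= [/hp le1 /hq le2 ->]].
by rewrite mnmDE leq_add.
Qed.

Lemma degree_inC (R : nzRingType) (n : nat) (i : 'I_n) (c : R) :
  degree_in i (mpolyC n c) = 0%N.
Proof.
apply/eqP; rewrite -leqn0; apply/degree_in_leP => m.
rewrite msuppC; case: eqP => // _; rewrite inE => /eqP ->.
by rewrite mnm0E.
Qed.

Lemma degree_in_prod_le (R : nzRingType) (n : nat) (i : 'I_n) (I : Type) (r : seq I)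
    (P : pred I) (F : I -> mpoly n R) (D : I -> nat) :
  (forall j, P j -> degree_in i (F j) <= D j)%N ->
  (degree_in i (\prod_(j <- r | P j) F j)%R <= \sum_(j <- r | P j) D j)%N.
Proof.
move=> le_D; elim/big_ind2: _ => // [|p D1 q D2].
  by rewrite -mpolyC1 degree_inC.
exact: degree_inM_le.
Qed.

Lemma degree_inX_le (R : nzRingType) (n : nat) (i : 'I_n) (p : mpoly n R) (D e : nat) :
  (degree_in i p <= D)%N -> (degree_in i (p ^+ e)%R <= D * e)%N.
Proof.
move=> le_D; rewrite -[e in p ^+ e]card_ord -prodr_const.
apply: leq_trans (degree_in_prod_le _ (D := fun=> D) _) _ => //.
by rewrite sum_nat_const card_ord mulnC.
Qed.

Lemma degree_in_mesym (R : nzRingType) (n : nat) (i : 'I_n) (k : nat) :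
  (degree_in i (mesym n R k) <= 1)%N.
Proof.
apply/degree_in_leP => m; rewrite msupp_mesymP => /existsP[h /andP[_ /eqP ->]].
by rewrite mnmE leq_b1.
Qed.

(* The algorithmic proof of the fundamental theorem, which subtracts from p
   the product of powers of the elementary symmetric polynomials with the same
   leading monomial m, never uses a product of total degree above m_0. *)
Lemma sym_fundamental_degree_in (R : comNzRingType) (n : nat)
    (p : mpoly n.+1 R) (D : nat) :
  p \is symmetric -> (degree_in ord0 p <= D)%N ->
  exists2 t, comp_mpoly [tuple mesym n.+1 R i.+1 | i < n.+1] t = p &
    degree_le D t.
Proof.
elim/mleadrect: p => p IHp sym_p le_D.
have [->|p_neq0] := eqVneq p 0.
  by exists 0; rewrite ?comp_mpoly0 // /degree_le msize0.
have := symf1P sym_p; have := mlead_msym_sorted sym_p.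
rewrite /symf1 (negPf p_neq0) /=; set m := mlead p.
pose c := nth 0%N (val m); set F := Multinom _ => sorted_m.
case/and3P => lt_q sym_q _.
have cE (i : 'I_n.+1) : c i = m i by rewrite /c (mnm_nth 0%N).
have deg_F : mdeg F = m ord0.
  rewrite mdegE (eq_bigr (fun i : 'I_n.+1 => c i - c i.+1)%N); last first.
    by move=> i _; rewrite mnmE.
  rewrite -(big_mkord xpredT (fun i => c i - c i.+1)%N) ssrcomplements.sumn_range //.
    by rewrite [X in (_ - X)%N]nth_default ?size_tuple // subn0 (cE ord0).
  move=> i j /andP[le_ij]; rewrite subn0 ltnS !addn0 leq_eqVlt.
  case/predU1P => [->|lt_j]; first by rewrite {1}/c nth_default ?size_tuple.
  have lt_i := leq_ltn_trans le_ij lt_j.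
  by have := sorted_m (Ordinal lt_i) (Ordinal lt_j) le_ij; rewrite -!cE.
have le_m : (m ord0 <= D)%N.
  by apply: (degree_in_leP _ _ _ le_D); rewrite mlead_supp.
have le_XS : (degree_in ord0 (comp_mpoly [tuple mesym n.+1 R i.+1 | i < n.+1]
    (mpolyX R F)) <= D)%N.
  apply: leq_trans le_m; rewrite -deg_F mdegE comp_mpolyX.
  apply: degree_in_prod_le => i _; rewrite -[X in (_ <= X)%N]mul1n.
  by rewrite degree_inX_le // tnth_map degree_in_mesym.
set q := p - _ in lt_q sym_q.
have [u uq le_u] : exists2 u,
    comp_mpoly [tuple mesym n.+1 R i.+1 | i < n.+1] u = q & degree_le D u.
  have [q0|q_neq0] := eqVneq q 0.
    by exists 0; rewrite ?comp_mpoly0 ?q0 // /degree_le msize0.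
  apply: IHp => //; first by case/predU1P: lt_q => // q0; rewrite q0 eqxx in q_neq0.
  by rewrite /q -scaleNr degree_inD_le ?degree_inZ_le.
exists (mcoeff m p *: mpolyX R F + u); last first.
  rewrite /degree_le (leq_trans (msizeD_le _ _)) // geq_max le_u andbT.
  by rewrite (leq_trans (msizeZ_le _ _)) // msizeX deg_F ltnS.
by rewrite linearD /= linearZ /= uq addrC subrK.
Qed.

(** By Vieta the elementary symmetric functions of the roots are, up to sign, the coefficients. One
    of these is [T] and the others are constants, so total degree at most [D] in the elementary
    symmetric functions becomes degree at most [D] in [T]. *)
Lemma sym_eval_roots_poly (F : idomainType) (d k D : nat) (p : mpoly d.+1 F) (a : nat -> F) :
  p \is symmetric -> (degree_in ord0 p <= D)%N ->
  exists2 Phi : {poly F}, (size Phi <= D.+1)%N &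
  forall (T : F) (al : d.+1.-tuple F),
    (forall j, (j < d.+1)%N ->
      (\prod_(c <- al) ('X - c%:P))`_j = if j == k then T else a j) ->
    Phi.[T] = meval (tnth al) p.
Proof.
move=> sym_p le_D; have [t tp le_t] := sym_fundamental_degree_in sym_p le_D.
(* The elementary symmetric function of degree [i.+1] is [(-1) ^+ i.+1] times the coefficient of
   index [d - i], the polynomial having degree [d.+1]. *)
pose u (i : 'I_d.+1) : {poly F} :=
  (-1) ^+ i.+1 *: (if (d - i == k)%N then 'X else (a (d - i)%N)%:P).
have size_u i : (size (u i) <= 2)%N.
  rewrite /u (leq_trans (size_scale_leq _ _)) //; case: ifP => _.
    by rewrite size_polyX.
  by rewrite (leq_trans (size_polyC_leq1 _)).
exists (mmap (@polyC F) u t).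
  apply/(leq_trans (size_sum _ _ _))/bigmax_leqP_seq => m m_t _.
  rewrite mul_polyC (leq_trans (size_scale_leq _ _)) //.
  rewrite (@leq_trans (mdeg m).+1) //; last first.
    exact: leq_trans (msize_mdeg_lt m_t) le_t.
  rewrite /mmap1 mdegE; elim/big_ind2: _ => [|q n r n' le_q le_r|i _].
  - by rewrite size_poly1.
  - apply: leq_trans (size_polyMleq _ _) _.
    by rewrite -subn1 leq_subLR add1n -addSn -addnS leq_add.
  elim: (m i) => [|e IHe]; first by rewrite expr0 size_poly1.
  rewrite exprS; apply: leq_trans (size_polyMleq _ _) _.
  by rewrite -subn1 leq_subLR (leq_add (size_u i) IHe).
move=> T al coef_al; rewrite -tp comp_mpoly_meval.
set v := (X in meval X t).
rewrite /meval /mmap horner_sum; apply: eq_bigr => m _.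
rewrite hornerM hornerC; congr (_ * _).
rewrite /mmap1 horner_prod; apply: eq_bigr => i _.
rewrite horner_exp; congr (_ ^+ _); rewrite /v tnth_map tnth_ord_tuple.
have := @mroots_coeff F _ al (lift ord0 i); rewrite lift0 subSS => coefE.
rewrite /u hornerZ -[RHS](signrMK i.+1) -coefE.
congr (_ * _); rewrite coef_al; last by rewrite ltnS leq_subr.
by case: ifP => _; rewrite ?hornerX ?hornerC.
Qed.

Definition proper_subset (d : nat) (S : {set 'I_d}) :=
  (0 < #|S| < d)%N.

(** At the roots of a monic polynomial this vanishes as soon as a monic factor of positive and not
    full degree has constant term [b], because that constant term is the product of the negated
    roots of the factor. *)
Definition subset_products (F : comNzRingType) (d : nat) (b : F) : mpoly d F :=
  \prod_(S : {set 'I_d} | proper_subset S)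
    (mpolyC d b - \prod_(i in S) - mpolyX F (mnm1 i)).

(** A permutation of the variables permutes the proper nonempty index sets, hence the factors. *)
Lemma subset_products_sym (F : comNzRingType) (d : nat) (b : F) :
  subset_products d b \is symmetric.
Proof.
apply/issymP => s; rewrite /subset_products rmorph_prod /=.
rewrite [RHS](reindex_inj (imset_inj (@perm_inj _ s))) /=.
apply: eq_big => [S|S _].
  by rewrite /proper_subset card_imset //; apply: perm_inj.
rewrite rmorphB /= rmorph_prod /=; congr (_ - _); first by rewrite /msym mmapC.
rewrite big_imset /=; last by move=> ? ? _ _; apply: perm_inj.
by apply: eq_bigr => i _; rewrite rmorphN /= /msym mmapX mmap1U.
Qed.

(** There are at most [2 ^ d] factors, each of degree at most one in every variable. *)
Lemma degree_in_subset_products (F : comNzRingType) (d : nat) (b : F) (i : 'I_d) :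
  (degree_in i (subset_products d b) <= 2 ^ d)%N.
Proof.
have -> : (2 ^ d = \sum_(S : {set 'I_d}) 1)%N.
  by rewrite sum1_card -cardsT -powersetT card_powerset cardsT card_ord.
rewrite [X in (_ <= X)%N](bigID (@proper_subset d)) /=.
apply: leq_trans (leq_addr _ _).
apply: degree_in_prod_le => S _; apply: degree_inD_le.
  by rewrite degree_inC.
rewrite -scaleN1r; apply: degree_inZ_le.
apply: leq_trans (degree_in_prod_le _ (D := fun j : 'I_d => (j == i) : nat) _) _.
  move=> j _; rewrite -scaleN1r; apply: degree_inZ_le.
  by apply/degree_in_leP => m; rewrite msuppX inE => /eqP ->; rewrite mnm1E.
rewrite -big_mkcondr /= sum1_card.
apply: leq_trans (subset_leq_card (B := [set i]) _) _; last by rewrite cards1.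
by apply/fintype.subsetP => j; rewrite !inE => /andP[].
Qed.

Lemma subset_products_eval (F : comNzRingType) (d : nat) (b : F) (al : 'I_d -> F) :
  meval al (subset_products d b) =
  \prod_(S : {set 'I_d} | proper_subset S) (b - \prod_(i in S) - al i).
Proof.
rewrite /subset_products rmorph_prod; apply: eq_bigr => S _ /=.
rewrite rmorphB /= mevalC rmorph_prod /=; congr (_ - _).
by apply: eq_bigr => i _; rewrite rmorphN /= mevalXU.
Qed.

End SymmetricPolynomials.

(** * Subset products of roots for a large parameter *)

Section LargeParameter.

Lemma norm_poly_sum_le (F : numFieldType) (d : nat) (a : nat -> F) (P : pred 'I_d) (x C : F) :
  0 <= C -> (forall j : 'I_d, P j -> `|x| ^+ j <= C) ->
  `|\sum_(j < d | P j) a j * x ^+ j| <= (\sum_(j < d) `|a j|) * C.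
Proof.
move=> C_ge0 le_C; apply: le_trans (ler_norm_sum _ _ _) _.
rewrite mulr_suml [leRHS](bigID P) /= -[leLHS]addr0 lerD //.
  by apply: ler_sum => j Pj; rewrite normrM normrX ler_wpM2l ?le_C.
by apply: sumr_ge0 => j _; rewrite mulr_ge0.
Qed.

(* At a root x of X^d + ... + T X^k + ... + a_0 two of the three terms x^d,
   T x^k, a_0 dominate: T x^k balances a_0 if |x| <= 1 and x^d if |x| > 1. *)
Lemma root_norm_large_parameter (F : numFieldType) (d k : nat) (a : nat -> F) :
  (0 < k < d)%N -> a 0%N != 0 ->
  exists M t0 : F, [/\ 1 <= M, 0 <= t0 & forall t x : F, t0 <= t -> 
    x ^+ d + \sum_(j < d) (if j == k :> nat then t else a j) * x ^+ j = 0 ->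
    if `|x| <= 1 then `|x| ^+ k * t <= M /\ 1 <= `|x| ^+ k * t * M
    else `|x| ^+ (d - k) <= t * M /\ t <= `|x| ^+ (d - k) * M].
Proof.
move=> /andP[k_gt0 lt_kd] a0_neq0.
have d_gt0 : (0 < d)%N by exact: leq_ltn_trans (leq0n k) lt_kd.
set A0 := \sum_(j < d) `|a j|; set A := 1 + A0; set v := `|a 0%N|.
have v_gt0 : 0 < v by rewrite normr_gt0.
have A0_ge0 : 0 <= A0 by apply: sumr_ge0.
have A_ge1 : 1 <= A by rewrite lerDl.
have A_gt0 : 0 < A by apply: lt_le_trans A_ge1.
(* The first summand of the threshold forces [A * r <= v / 2] at a root of norm [r] at most 1, the
   second forces [2 * A <= r] at the other roots. In [M], the summand 2 gives the upper bound on
   large roots, [2 / v] the lower bound on small ones, and [A] the two remaining bounds. *)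
exists (A + 2 + 2 / v), (A * (2 * A / v) ^+ k + A * (2 * A) ^+ (d - k)); split.
- by apply: le_trans A_ge1 _; rewrite -addrA lerDl addr_ge0 ?divr_ge0 ?ler0n ?ltW.
- by rewrite addr_ge0 ?mulr_ge0 ?exprn_ge0 ?divr_ge0 ?mulr_ge0 ?ltW.
move=> t x le_t.
have t_small : A * (2 * A / v) ^+ k <= t.
  by apply: le_trans le_t; rewrite lerDl mulr_ge0 ?exprn_ge0 ?mulr_ge0 ?ltW.
have t_large : A * (2 * A) ^+ (d - k) <= t.
  by apply: le_trans le_t; rewrite lerDr mulr_ge0 ?exprn_ge0 ?divr_ge0 ?mulr_ge0 ?ltW.
have t_gt0 : 0 < t.
  by apply: lt_le_trans t_large; rewrite mulr_gt0 ?exprn_gt0 ?mulr_gt0.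
have MA : A <= A + 2 + 2 / v by rewrite -addrA lerDl addr_ge0 ?divr_ge0 ?ltW.
have M2 : 2 <= A + 2 + 2 / v.
  by rewrite (addrC A) -addrA lerDl addr_ge0 ?divr_ge0 ?ltW.
have Mv : 2 / v <= A + 2 + 2 / v by rewrite lerDr addr_ge0 ?ltW.
move: (A + 2 + 2 / v) MA M2 Mv => M MA M2 Mv.
pose ko := Ordinal lt_kd.
rewrite (bigD1 ko) //= eqxx.
rewrite (eq_bigr (fun j : 'I_d => a j * x ^+ j)); last first.
  by move=> j /negPf j_k; rewrite -[k]/(val ko) val_eqE j_k.
set s := \sum_(j < d | j != ko) _ => eq0.
set r := `|x|; have r_ge0 : 0 <= r by apply: normr_ge0.
have eq_t : t * x ^+ k = - (x ^+ d + s).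
  by apply/eqP; rewrite -subr_eq0 opprK addrC -addrA [s + _]addrC addrA -eq0 addrA.
have norm_t : t * r ^+ k = `|x ^+ d + s|.
  by rewrite -[RHS]normrN -eq_t normrM normrX gtr0_norm.
case: ifP => r_le1.
  have le_A : t * r ^+ k <= A.
    rewrite norm_t (le_trans (ler_normD _ _)) // lerD //.
      by rewrite normrX exprn_ile1.
    rewrite -[leRHS]mulr1; apply: norm_poly_sum_le => // j _.
    by rewrite exprn_ile1.
  have r_small : A * r <= v / 2.
    have Ar_ge0 : A * r \is Num.nneg by rewrite nnegrE mulr_ge0 // ltW.
    have v2_ge0 : v / 2 \is Num.nneg by rewrite nnegrE divr_ge0 ?ltW.
    rewrite -(ler_pXn2r k_gt0 Ar_ge0 v2_ge0).
    have : r ^+ k * (2 * A / v) ^+ k <= 1.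
      rewrite -(ler_pM2l A_gt0) mulr1; apply: le_trans le_A.
      by rewrite mulrCA mulrC ler_wpM2r ?exprn_ge0.
    rewrite -exprMn => le1. rewrite -[leRHS]mul1r -ler_pdivrMr; last first.
      by rewrite exprn_gt0 ?divr_gt0.
    apply: le_trans le1; rewrite -exprVn -exprMn invf_div.
    suff -> : A * r * (2 / v) = r * (2 * A / v) by [].
    by ring.
  (* Isolate the constant coefficient, of norm [v]: the terms other than [t * x ^+ k] amount to at
     most [A * r], hence to at most half of [v]. *)
  have lt_v : v / 2 <= t * r ^+ k.
    pose o := Ordinal d_gt0.
    have ko_o : ko != o by rewrite -val_eqE /= -lt0n.
    have : - a 0%N = t * x ^+ k + (x ^+ d + \sum_(j < d | (j != ko) && (j != o)) a j * x ^+ j).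
      apply/eqP; rewrite -subr_eq0 eq_t /s (bigD1 o) 1?eq_sym //= expr0 mulr1.
      by apply/eqP; ring.
    move/(congr1 Num.norm); rewrite normrN -/v => v_eq.
    have : v <= t * r ^+ k + A * r.
      rewrite v_eq (le_trans (ler_normD _ _)) // lerD //.
        by rewrite normrM normrX gtr0_norm.
      rewrite (le_trans (ler_normD _ _)) // mulrDl mul1r lerD //.
        by rewrite normrX -[leRHS]expr1 ler_wiXn2l.
      apply: norm_poly_sum_le => // j /andP[_ j_neq0].
      by rewrite -[leRHS]expr1 ler_wiXn2l // lt0n -[0%N]/(val o) val_eqE.
    move=> le_v; rewrite -(lerD2r (v / 2)) -splitr.
    by apply: le_trans le_v _; rewrite lerD2l.
  rewrite [r ^+ k * t]mulrC; split; first exact: le_trans le_A _.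
  rewrite -ler_pdivrMr; last by apply: lt_le_trans M2.
  apply: le_trans lt_v; rewrite mul1r -[leRHS]invrK lef_pV2 ?posrE //; last first.
    by rewrite invr_gt0 divr_gt0.
    by apply: lt_le_trans M2.
  by rewrite invf_div.
have r_gt1 : 1 < r.
  by rewrite real_ltNge ?r_le1 // ?real1 // normr_real.
have r_gt0 : 0 < r by apply: lt_trans r_gt1.
have le_tA : t <= A * r ^+ (d - k).
  rewrite -(@ler_pM2r _ (r ^+ k)) ?exprn_gt0 // -mulrA -exprD subnK 1?ltnW //.
  rewrite norm_t (le_trans (ler_normD _ _)) // mulrDl mul1r lerD ?normrX //.
  apply: norm_poly_sum_le => [|j _]; first exact: exprn_ge0.
  by apply: ler_weXn2l; [exact: ltW|exact: ltnW].
have r_large : 2 * A <= r.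
  have dk_gt0 : (0 < d - k)%N by rewrite subn_gt0.
  have A2_ge0 : 2 * A \is Num.nneg by rewrite nnegrE mulr_ge0 // ltW.
  rewrite -(ler_pXn2r dk_gt0 A2_ge0) ?nnegrE //.
  by rewrite -(ler_pM2l A_gt0) (le_trans t_large).
(* Since [2 * A <= r], the terms other than [x ^+ d] and [t * x ^+ k] amount to at most half of
   [r ^+ d], so [t * r ^+ k] is at least the other half. *)
have le_2t : r ^+ (d - k) <= 2 * t.
  rewrite -(@ler_pM2r _ (r ^+ k)) ?exprn_gt0 // -exprD subnK 1?ltnW //.
  have le1 : r ^+ d <= t * r ^+ k + A * r ^+ d.-1.
    have -> : r ^+ d = `|- (t * x ^+ k) - s|.
      by rewrite eq_t opprK addrK normrX.
    rewrite (le_trans (ler_normB _ _)) // normrN normrM normrX gtr0_norm // lerD2l.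
    apply: (@le_trans _ _ (A0 * r ^+ d.-1)).
      apply: norm_poly_sum_le => [|j _]; first exact: exprn_ge0.
      apply: ler_weXn2l; first exact: ltW.
      by rewrite -ltnS prednK.
    by rewrite ler_wpM2r ?exprn_ge0 // lerDr.
  have le2 : 2 * (A * r ^+ d.-1) <= r ^+ d.
    by rewrite -[d in leRHS](prednK d_gt0) exprS mulrA ler_wpM2r ?exprn_ge0.
  have : 2 * r ^+ d <= 2 * (t * r ^+ k) + r ^+ d.
    by apply: (@le_trans _ _ (2 * (t * r ^+ k + A * r ^+ d.-1)));
      rewrite ?ler_wpM2l // mulrDr lerD2l.
  by rewrite [2 * r ^+ d]mulr_natl mulr2n lerD2r mulrA.
split; first by apply: le_trans le_2t _; rewrite mulrC ler_wpM2l // ltW.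
by apply: le_trans le_tA _; rewrite mulrC ler_wpM2l // ltW ?exprn_gt0.
Qed.

Lemma prodXsubC_root_eq (F : idomainType) (d : nat) (al : d.-tuple F) (i : 'I_d) :
  let p := \prod_(c <- al) ('X - c%:P) in
  tnth al i ^+ d + \sum_(j < d) p`_j * tnth al i ^+ j = 0.
Proof.
move=> p; have size_p : size p = d.+1 by rewrite size_prod_XsubC size_tuple.
have p_monic : p \is monic by apply: monic_prod_XsubC.
have : p.[tnth al i] = 0 by apply/rootP; rewrite root_prod_XsubC mem_tnth.
rewrite horner_coef size_p big_ord_recr /=.
have -> : p`_d = 1 by rewrite -(monicP p_monic) lead_coefE size_p.
by rewrite mul1r addrC.
Qed.

(** Equality would give [d * n1 = k * (n1 + n2)], so [d] would divide [n1 + n2] by coprimality,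
    although this sum lies strictly between 0 and [d]. *)
Lemma subset_product_balance (d k n1 n2 : nat) :
  coprime k d -> (k < d)%N -> (0 < n1 + n2 < d)%N -> ((d - k) * n1 != k * n2)%N.
Proof.
move=> co_kd lt_kd /andP[n_gt0 lt_nd]; apply/eqP => eq_n.
have : (d %| k * (n1 + n2))%N.
  by rewrite mulnDr -eq_n -mulnDl subnKC ?dvdn_mulr // ltnW.
rewrite Gauss_dvdr 1?coprime_sym // => /(dvdn_leq n_gt0).
by rewrite leqNgt lt_nd.
Qed.

(** Raising norms to the power [k * (d - k)] avoids fractional exponents: a product over [n1] small
    and [n2] large roots then has size [t] to the power [k * n2 - (d - k) * n1], up to a constant
    factor. This exponent is a nonzero integer, so for large [t] the product cannot have the fixed
    norm of [b]. *)
Lemma subset_product_neq (F : numFieldType) (d k : nat) (a : nat -> F) (b : F) :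
  (0 < k < d)%N -> coprime k d -> a 0%N != 0 -> b != 0 ->
  exists T : F, forall al : d.-tuple F,
    (forall j, (j < d)%N ->
      (\prod_(c <- al) ('X - c%:P))`_j = if j == k then T else a j) ->
    forall S : {set 'I_d}, proper_subset S -> \prod_(i in S) - tnth al i != b.
Proof.
move=> k_bounds co_kd a0_neq0 b_neq0.
have [M [t0 [M_ge1 t0_ge0 root_t]]] := root_norm_large_parameter k_bounds a0_neq0.
have /andP[k_gt0 lt_kd] := k_bounds.
pose B := `|b| ^+ (k * (d - k)); have B_gt0 : 0 < B by rewrite exprn_gt0 ?normr_gt0.
have M_ge0 : 0 <= M by apply: le_trans M_ge1.
pose MN := M ^+ (d * d); have MN_ge0 : 0 <= MN by apply: exprn_ge0.
(* Besides reaching [t0] for the root estimates, [t] must exceed [B * MN] and [MN / B], to refute a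
   positive and a negative exponent respectively. *)
pose t := t0 + (B * MN + (MN / B + 1)).
have t_ge1 : 1 <= t.
  by rewrite /t !addrA lerDr !addr_ge0 ?mulr_ge0 ?invr_ge0 ?(ltW B_gt0).
have t_gt0 : 0 < t by apply: lt_le_trans t_ge1.
have t_t0 : t0 <= t by rewrite /t lerDl !addr_ge0 ?mulr_ge0 ?invr_ge0 ?(ltW B_gt0).
have t_up : B * MN < t.
  by rewrite /t addrCA ltrDl !ltr_wpDl ?mulr_ge0 ?invr_ge0 ?(ltW B_gt0).
have t_down : MN / B < t.
  by rewrite /t addrA addrCA ltrDl !ltr_wpDl ?addr_ge0 ?mulr_ge0 ?(ltW B_gt0).
exists t => al coef_al S proper_S; apply/eqP => eq_b.
pose small i := `|tnth al i| <= 1.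
(* [X i] has the size of [t ^+ l i / t ^+ s i], up to a factor [M ^+ d]; the two exponents are kept
   apart so that both are natural numbers. *)
pose s i := if small i then (d - k)%N else 0%N.
pose l i := if small i then 0%N else k.
pose X i := `|tnth al i| ^+ (k * (d - k)).
have X_ge0 i : 0 <= X i by apply: exprn_ge0.
have Md e : (e <= d)%N -> M ^+ e <= M ^+ d by move=> le_e; apply: ler_weXn2l.
have bal i : X i * t ^+ s i <= t ^+ l i * M ^+ d /\ t ^+ l i <= X i * t ^+ s i * M ^+ d.
  have := root_t t (tnth al i) t_t0.
  rewrite (eq_bigr (fun j : 'I_d => (\prod_(c <- al) ('X - c%:P))`_j * tnth al i ^+ j)); last first.
    by move=> j _; rewrite coef_al.
  move/(_ (prodXsubC_root_eq al i)); rewrite /X /s /l /small.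
  have [_|_] := boolP (`|tnth al i| <= 1) => -[le1 le2].
    rewrite exprM -exprMn expr0 mul1r; split.
      apply: le_trans (Md (d - k)%N (leq_subr _ _)).
      by rewrite lerXn2r // nnegrE ?mulr_ge0 ?exprn_ge0 // ltW.
    apply: (@le_trans _ _ ((`|tnth al i| ^+ k * t * M) ^+ (d - k))).
      by rewrite exprn_ege1.
    by rewrite [leLHS]exprMn ler_wpM2l ?exprn_ge0 ?mulr_ge0 ?exprn_ge0 ?(ltW t_gt0) // Md ?leq_subr.
  rewrite mulnC exprM expr0 mulr1; split.
    apply: (@le_trans _ _ ((t * M) ^+ k)).
      by rewrite lerXn2r // nnegrE ?mulr_ge0 ?exprn_ge0 // ltW.
    by rewrite exprMn ler_wpM2l ?exprn_ge0 ?(ltW t_gt0) // Md // ltnW.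
  apply: (@le_trans _ _ ((`|tnth al i| ^+ (d - k) * M) ^+ k)).
    by rewrite lerXn2r // nnegrE ?mulr_ge0 ?exprn_ge0 // ltW.
  by rewrite exprMn ler_wpM2l ?exprn_ge0 // Md // ltnW.
have prodX : \prod_(i in S) X i = B.
  rewrite /B -eq_b normr_prod prodrXl; congr (_ ^+ _).
  by apply: eq_bigr => i _; rewrite normrN.
have MS : \prod_(i in S) M ^+ d <= MN.
  rewrite prodr_const -exprM; apply: ler_weXn2l => //.
  by rewrite leq_mul2l (leq_trans (max_card _)) ?card_ord ?orbT.
have up : B * t ^+ (\sum_(i in S) s i) <= t ^+ (\sum_(i in S) l i) * MN.
  apply: (@le_trans _ _ (\prod_(i in S) (t ^+ l i * M ^+ d))).
    rewrite -prodX -prodrXr -big_split /=; apply: ler_prod => i _.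
    by rewrite mulr_ge0 ?exprn_ge0 ?(ltW t_gt0) //; case: (bal i).
  by rewrite big_split /= prodrXr ler_wpM2l ?exprn_ge0 ?(ltW t_gt0).
have down : t ^+ (\sum_(i in S) l i) <= B * t ^+ (\sum_(i in S) s i) * MN.
  apply: (@le_trans _ _ (\prod_(i in S) (X i * t ^+ s i * M ^+ d))).
    rewrite -prodrXr; apply: ler_prod => i _.
    by rewrite exprn_ge0 ?(ltW t_gt0) //; case: (bal i).
  rewrite !big_split /= prodX prodrXr ler_wpM2l // mulr_ge0 ?exprn_ge0 ?(ltW t_gt0) //.
have sE : (\sum_(i in S) s i = (d - k) * #|[set i in S | small i]|)%N.
  rewrite (bigID small) /= [X in (_ + X)%N]big1 ?addn0 => [|i /andP[_ /negPf]]; last first.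
    by rewrite /s => ->.
  rewrite (eq_bigr (fun=> (d - k)%N)) => [|i /andP[_]]; last by rewrite /s => ->.
  by rewrite sum_nat_const mulnC cardsE.
have lE : (\sum_(i in S) l i = k * #|[set i in S | ~~ small i]|)%N.
  rewrite (bigID small) /= [X in (X + _)%N]big1 ?add0n => [|i /andP[_]]; last first.
    by rewrite /l => ->.
  rewrite (eq_bigr (fun=> k)) => [|i /andP[_ /negPf]]; last by rewrite /l => ->.
  by rewrite sum_nat_const mulnC cardsE.
have cardE : (#|[set i in S | small i]| + #|[set i in S | ~~ small i]| = #|S|)%N.
  by rewrite -!sum1_card [RHS](bigID small) /=; congr (_ + _)%N;
    apply: eq_bigl => i; rewrite inE.
have := @subset_product_balance d k #|[set i in S | small i]| #|[set i in S | ~~ small i]|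
  co_kd lt_kd.
rewrite cardE -sE -lE => /(_ proper_S).
rewrite neq_ltn => /orP[lt_sl|lt_ls].
  suff : t <= B * MN by rewrite lt_geF.
  rewrite -(@ler_pM2r _ (t ^+ (\sum_(i in S) s i))) ?exprn_gt0 // -exprS mulrAC.
  by apply: le_trans down; apply: ler_weXn2l.
suff : t <= MN / B by rewrite lt_geF.
rewrite ler_pdivlMr // -(@ler_pM2r _ (t ^+ (\sum_(i in S) l i))) ?exprn_gt0 //.
rewrite [MN * _]mulrC; apply: le_trans up.
by rewrite mulrAC -exprS mulrC ler_wpM2l ?ler_weXn2l // ltW.
Qed.

End LargeParameter.

(** * Parameters for which the polynomial is reducible *)

Section ReducibleParameters.

Lemma size_monic_of (d : nat) (a : nat -> int) : size (monic_of d a) = d.+1.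
Proof.
by rewrite /monic_of size_polyDl size_polyXn // ltnS size_poly.
Qed.

Lemma monic_of_monic (d : nat) (a : nat -> int) : monic_of d a \is monic.
Proof.
by rewrite monicE lead_coefE size_monic_of coefD coefXn eqxx coef_poly ltnn addr0.
Qed.

Lemma coef_monic_of (d : nat) (a : nat -> int) (j : nat) :
  (j < d)%N -> (monic_of d a)`_j = a j.
Proof. by move=> lt_jd; rewrite coefD coefXn ltn_eqF // coef_poly lt_jd add0r. Qed.

Lemma monic_poly_normal (F : closedFieldType) (p : {poly F}) :
  p \is monic -> exists2 s : seq F, p = \prod_(z <- s) ('X - z%:P) & (size s).+1 = size p.
Proof.
move=> /monicP p_monic; have [s ps] := closed_field_poly_normal p.
rewrite p_monic scale1r in ps; exists s => //.
by rewrite ps size_prod_XsubC.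
Qed.

(** The roots of one factor are listed first, so that an initial segment of indices represents them
    with multiplicity. *)
Lemma prod_take_subset (F : comNzRingType) (d : nat) (be ga : seq F) (al : d.-tuple F) :
  tval al = be ++ ga ->
  \prod_(i in [set i : 'I_d | (i < size be)%N]) - tnth al i = \prod_(z <- be) - z.
Proof.
move=> alE; have le_d : (size be <= d)%N.
  by rewrite -(size_tuple al) alE size_cat leq_addr.
rewrite [RHS](big_nth 0) big_mkord (big_ord_widen _ (fun i => - be`_i) le_d).
apply: eq_big => [i|i]; rewrite inE // => lt_i.
by rewrite (tnth_nth 0) alE nth_cat lt_i.
Qed.

(** With everything but [T] frozen, a factor of constant term [b] makes [T] a root of [Phi], a
    nonzero polynomial of degree at most [2 ^ d]. The argument takes place in [algC], where all the
    polynomials involved split. *)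
Lemma reducible_parameters (d k : nat) (a : nat -> int) (b : int) :
  (0 < k < d)%N -> coprime k d -> a 0%N != 0 -> b != 0 ->
  exists2 s : seq int, (size s <= 2 ^ d)%N &
  forall (T : int) (q r : {poly int}), q \is monic ->
    (1 < size q)%N -> (1 < size r)%N -> q`_0 = b ->
    monic_of d (fun j => if j == k then T else a j) = q * r -> T \in s.
Proof.
case: d => [|d] k_bounds co_kd a0_neq0 b_neq0; first by rewrite ltn0 andbF in k_bounds.
pose aC j : algC := (a j)%:~R; pose bC : algC := b%:~R.
have aC_neq0 : aC 0%N != 0 by rewrite intr_eq0.
have bC_neq0 : bC != 0 by rewrite intr_eq0.
have [Phi size_Phi PhiE] := sym_eval_roots_poly k aC (subset_products_sym d.+1 bC)
  (degree_in_subset_products bC ord0).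
have [T0 neq_T0] := subset_product_neq k_bounds co_kd aC_neq0 bC_neq0.
(* For the parameter [T0] no factor of the subset product vanishes at the roots, so [Phi] is nonzero
   at [T0]. *)
have Phi_neq0 : Phi != 0.
  pose p : {poly algC} := 'X^(d.+1) + \poly_(j < d.+1) (if j == k then T0 else aC j).
  have size_p : size p = d.+2.
    by rewrite /p size_polyDl size_polyXn // ltnS size_poly.
  have p_monic : p \is monic.
    by rewrite monicE lead_coefE size_p coefD coefXn eqxx coef_poly ltnn addr0.
  have [s ps size_s] := monic_poly_normal p_monic.
  have size_sd : size s == d.+1 by rewrite -eqSS size_s size_p.
  have coef_s j : (j < d.+1)%N ->
      (\prod_(c <- Tuple size_sd) ('X - c%:P))`_j = if j == k then T0 else aC j.
    by move=> lt_j; rewrite -ps coefD coefXn ltn_eqF // coef_poly lt_j add0r.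
  apply: contraTneq isT => Phi0; have := PhiE T0 _ coef_s.
  rewrite Phi0 horner0 subset_products_eval => /esym/eqP.
  rewrite prodf_seq_eq0 => /hasP[S _ /andP[proper_S]].
  by rewrite subr_eq0 eq_sym => /eqP eqb; have := neq_T0 _ coef_s S proper_S; rewrite eqb eqxx.
have [zs Phi_zs] := closed_field_poly_normal Phi.
have size_zs : (size zs <= 2 ^ d.+1)%N.
  rewrite -ltnS (leq_trans _ size_Phi) // Phi_zs size_scale ?lead_coef_eq0 //.
  by rewrite size_prod_XsubC.
(* Only integer roots matter and [Num.floor] recovers them; its values at the other roots are
   harmless extra entries. *)
exists [seq Num.floor z | z <- zs]; first by rewrite size_map.
move=> T q r q_monic size_q size_r q0 fqr.
have r_monic : r \is monic by rewrite -(monicMl _ q_monic) -fqr monic_of_monic.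
pose toC (p : {poly int}) : {poly algC} := map_poly intr p.
have toC_monic p : p \is monic -> toC p \is monic by apply: monic_map.
have [be qE size_be] := monic_poly_normal (toC_monic _ q_monic).
have [ga rE size_ga] := monic_poly_normal (toC_monic _ r_monic).
have size_toC p : p \is monic -> size (toC p) = size p.
  by move=> /monicP p_monic; rewrite size_map_poly_id0 // p_monic oner_eq0.
rewrite size_toC // in size_be; rewrite size_toC // in size_ga.
have size_al : size (be ++ ga) == d.+1.
  have := congr1 (size \o toC) fqr; rewrite /= size_toC ?monic_of_monic // size_monic_of.
  by rewrite /toC rmorphM /= -/(toC q) -/(toC r) qE rE -big_cat size_prod_XsubC => -[->].
pose al := Tuple size_al.
have coef_al j : (j < d.+1)%N ->
    (\prod_(c <- al) ('X - c%:P))`_j = if j == k then T%:~R else aC j.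
  move=> lt_j; rewrite /= big_cat /= -qE -rE /toC -rmorphM -fqr /=.
  by rewrite coef_map /= coef_monic_of //; case: ifP.
have rootT : root Phi T%:~R.
  rewrite rootE (PhiE _ al coef_al) subset_products_eval.
  pose S := [set i : 'I_d.+1 | (i < size be)%N].
  have be_le : (size be < d.+1)%N.
    by rewrite -(eqP size_al) size_cat -[X in (X < _)%N]addn0 ltn_add2l -ltnS size_ga.
  have card_S : #|S| = size be.
    rewrite -sum1_card; under eq_bigl do rewrite inE.
    by rewrite -(big_ord_widen _ (fun=> 1%N) (ltnW be_le)) sum1_card card_ord.
  have proper_S : proper_subset S.
    by rewrite /proper_subset card_S be_le andbT -ltnS size_be.
  have be_b : \prod_(z <- be) - z = bC.
    rewrite /bC -q0 -(coef_map intr q) -/(toC q) qE -horner_coef0 horner_prod.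
    by apply: eq_bigr => z _; rewrite hornerXsubC sub0r.
  by rewrite (bigD1 S) //= (@prod_take_subset _ _ be ga) // be_b subrr mul0r.
rewrite Phi_zs rootZ ?lead_coef_eq0 // root_prod_XsubC in rootT.
by apply/mapP; exists T%:~R; rewrite // intrKfloor.
Qed.

Definition signed_divisors (c : int) : seq int :=
  [seq n%:Z | n <- divisors `|c|%N] ++ [seq - n%:Z | n <- divisors `|c|%N].

Lemma size_signed_divisors (c : int) : size (signed_divisors c) = (2 * tau c)%N.
Proof. by rewrite size_cat !size_map mul2n -addnn. Qed.

Lemma mem_signed_divisors (b c : int) :
  c != 0 -> (b %| c)%Z -> b \in signed_divisors c.
Proof.
move=> c_neq0 b_c; have b_div : `|b|%N \in divisors `|c|%N.
  by rewrite -dvdn_divisors // absz_gt0.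
rewrite mem_cat; case: (intP b) b_div => [|n|n] b_div.
- by rewrite (map_f Posz b_div).
- by rewrite (map_f Posz b_div).
by rewrite abszN in b_div; rewrite (map_f (fun n => - n%:Z) b_div) orbT.
Qed.

(** The leading coefficients of the two factors multiply to 1, so both are 1 or both are -1; in the
    second case both factors are negated. *)
Lemma monic_factorP (p : {poly int}) : p \is monic -> (1 < size p)%N -> ~ irreducibleZ p ->
  exists q r : {poly int}, [/\ q \is monic, (1 < size q)%N, (1 < size r)%N & p = q * r].
Proof.
move=> p_monic size_p /not_andP[//|/existsNP[q /existsNP[r]]].
move=> /not_implyP[size_q /not_implyP[size_r /contrapT pE]].
have lead_qr : lead_coef q * lead_coef r = 1 by rewrite -lead_coefM -pE (monicP p_monic).
have : (`|lead_coef q| * `|lead_coef r| = 1)%N by rewrite -abszM lead_qr.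
move/eqP; rewrite muln_eq1 => /andP[/eqP lead_q _].
have [lq|lq] : lead_coef q = 1 \/ lead_coef q = -1 by lia.
  by exists q, r; rewrite monicE lq.
by exists (- q), (- r); rewrite monicE lead_coefN lq opprK !size_polyN mulrNN.
Qed.

(** The constant term of a monic factor divides that of the polynomial, which leaves finitely many
    values of [b] to try. *)
Lemma reducible_parameters_cover (d k : nat) (a : nat -> int) :
  (0 < k < d)%N -> coprime k d -> a 0%N != 0 ->
  exists2 S : int -> seq int, (forall b, size (S b) <= 2 ^ d)%N &
  forall T : int,
    ~ irreducibleZ (monic_of d (fun j => if j == k then T else a j)) ->
    exists2 b, b \in signed_divisors (a 0%N) & T \in S b.
Proof.
move=> k_bounds co_kd a0_neq0.
have /choice[S SP] : forall b, exists s : seq int, (size s <= 2 ^ d)%N /\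
    (b != 0 -> forall (T : int) (q r : {poly int}), q \is monic ->
    (1 < size q)%N -> (1 < size r)%N -> q`_0 = b ->
    monic_of d (fun j => if j == k then T else a j) = q * r -> T \in s).
  move=> b; have [->|b_neq0] := eqVneq b 0; first by exists [::].
  by have [s size_s s_cover] := reducible_parameters k_bounds co_kd a0_neq0 b_neq0; exists s.
exists S => [b|T]; first by case: (SP b).
have d_gt0 : (0 < d)%N by case/andP: k_bounds => _; apply: leq_ltn_trans.
move=> /(monic_factorP (monic_of_monic _ _)).
rewrite size_monic_of ltnS => /(_ d_gt0)[q [r [q_monic size_q size_r fqr]]].
(* The parameter sits at index [k > 0], so the constant coefficient does not depend on [T]. *)
have a0E : a 0%N = q`_0 * r`_0.
  rewrite -!horner_coef0 -hornerM -fqr horner_coef0 coef_monic_of //.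
  by case: eqP k_bounds => // <-.
have q0_neq0 : q`_0 != 0 by apply: contra_neq a0_neq0; rewrite a0E => ->; rewrite mul0r.
exists (q`_0).
  by apply: mem_signed_divisors => //; rewrite a0E dvdz_mulr.
by case: (SP q`_0) => _ /(_ q0_neq0 T q r); apply.
Qed.

End ReducibleParameters.

(** * Divisor functions *)

Section Divisors.

Local Open Scope nat_scope.

Lemma size_divisors_gt0 (m : nat) : 0 < m -> 0 < size (divisors m).
Proof.
move=> m_gt0; have : 1 \in divisors m by rewrite -dvdn_divisors // dvd1n.
by case: (divisors m).
Qed.

Lemma dvdn_size_divisors (m n : nat) :
  0 < n -> m %| n -> size (divisors m) <= size (divisors n).
Proof.
move=> n_gt0 m_n; have m_gt0 := dvdn_gt0 n_gt0 m_n.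
apply: uniq_leq_size (divisors_uniq m) _ => e.
by rewrite -!dvdn_divisors // => /dvdn_trans; apply.
Qed.

(** A divisor [e] of [a * b] is the product of [gcdn e a], which divides [a], and of
    [e %/ gcdn e a], which divides [b]. *)
Lemma size_divisorsM (a b : nat) : 0 < a -> 0 < b ->
  size (divisors (a * b)) <= size (divisors a) * size (divisors b).
Proof.
move=> a_gt0 b_gt0; rewrite -(size_allpairs muln); apply: uniq_leq_size (divisors_uniq _) _ => e.
rewrite -dvdn_divisors ?muln_gt0 ?a_gt0 // => e_ab.
have e_gt0 : 0 < e by apply: dvdn_gt0 e_ab; rewrite muln_gt0 a_gt0.
have g_gt0 : 0 < gcdn e a by rewrite gcdn_gt0 e_gt0.
apply/allpairsP; exists (gcdn e a, e %/ gcdn e a) => /=; split.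
- by rewrite -dvdn_divisors // dvdn_gcdr.
- rewrite -dvdn_divisors //.
  have co : coprime (e %/ gcdn e a) (a %/ gcdn e a).
    by rewrite /coprime -(eqn_pmul2r g_gt0) mul1n muln_gcdl !divnK ?dvdn_gcdl ?dvdn_gcdr.
  rewrite -(Gauss_dvdr _ co) -(dvdn_pmul2r g_gt0) divnK ?dvdn_gcdl //.
  by rewrite mulnAC divnK ?dvdn_gcdr.
by rewrite mulnC divnK ?dvdn_gcdl.
Qed.

Lemma size_divisors_prime (p : nat) : prime p -> size (divisors p) = 2.
Proof.
move=> p_pr; have /primeP[p_gt1 divp] := p_pr.
apply/eqP; rewrite eqn_leq; apply/andP; split.
  apply: (@uniq_leq_size _ _ [:: 1; p] (divisors_uniq p)) => e.
  by rewrite -dvdn_divisors 1?prime_gt0 // => /divp; rewrite !inE.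
apply: (@uniq_leq_size _ [:: 1; p]); first by rewrite /= inE eq_sym gtn_eqF.
by move=> e; rewrite !inE -dvdn_divisors 1?prime_gt0 // => /orP[] /eqP ->.
Qed.

(* Peel off the least divisor a > X of m: if p is a prime factor of a, then
   a / p <= X by minimality, and tau a <= 2 tau (a / p). *)
Lemma size_divisors_le_small (X k m : nat) : 0 < m -> m < X ^ k.+1 ->
  exists2 e, (e %| m) && (e <= X) &
    size (divisors m) <= 2 ^ k * size (divisors e) ^ k.+1.
Proof.
elim: k m => [|k IHk] m m_gt0 lt_m.
  by exists m; rewrite ?dvdnn ?expn1 ?mul1n // -[X]expn1 ltnW.
have X_gt0 : 0 < X by case: X lt_m {IHk}.
have [le_mX|lt_Xm] := leqP m X.
  exists m; first by rewrite dvdnn.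
  rewrite [X in _ * X]expnS mulnCA -[leqLHS]muln1 leq_mul2l muln_gt0 !expn_gt0.
  by rewrite size_divisors_gt0 ?orbT.
have ex_a : exists a, (a %| m) && (X < a) by exists m; rewrite dvdnn.
case: (ex_minnP ex_a) => a /andP[a_m lt_Xa] min_a.
have a_gt1 : 1 < a by apply: leq_ltn_trans lt_Xa.
have p_pr := pdiv_prime a_gt1; set p := pdiv a in p_pr.
have aE : a = p * (a %/ p) by rewrite mulnC divnK ?pdiv_dvd.
set a' := a %/ p in aE.
have a'_gt0 : 0 < a' by case: a' aE a_gt1 => // ->; rewrite muln0.
have a'_m : a' %| m by apply: dvdn_trans a_m; rewrite aE dvdn_mull.
have le_a'X : a' <= X.
  rewrite leqNgt; apply/negP => lt_Xa'; have := min_a a'; rewrite a'_m lt_Xa' => /(_ isT).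
  by rewrite leqNgt ltn_Pdiv ?prime_gt1 // ltnW.
have tau_a : size (divisors a) <= 2 * size (divisors a').
  by have := size_divisorsM (prime_gt0 p_pr) a'_gt0; rewrite -aE (size_divisors_prime p_pr).
have mE : m = a * (m %/ a) by rewrite mulnC divnK.
set m' := m %/ a in mE.
have m'_gt0 : 0 < m' by case: m' mE m_gt0 => // ->; rewrite muln0.
have lt_m' : m' < X ^ k.+1.
  rewrite -(ltn_pmul2l X_gt0) -expnS; apply: leq_ltn_trans lt_m.
  by rewrite mE leq_mul2r ltnW ?orbT.
have [e /andP[e_m' le_eX] tau_m'] := IHk m' m'_gt0 lt_m'.
have e_m : e %| m by apply: dvdn_trans e_m' _; rewrite mE dvdn_mull.
have tau_m : size (divisors m) <=
    2 ^ k.+1 * (size (divisors a') * size (divisors e) ^ k.+1).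
  rewrite {1}mE; apply: leq_trans (size_divisorsM _ _) _ => //; first by apply: ltnW.
  apply: leq_trans (leq_mul tau_a tau_m') _.
  by rewrite mulnACA -expnS.
(* Both [a'] and [e] are divisors of [m] not exceeding [X]; the one with more divisors is kept. *)
have [le_t|/ltnW le_t] := leqP (size (divisors a')) (size (divisors e)).
  exists e; rewrite ?e_m //; apply: leq_trans tau_m _.
  by rewrite leq_mul2l [leqRHS]expnS leq_mul2r le_t !orbT.
exists a'; rewrite ?a'_m //; apply: leq_trans tau_m _.
by rewrite leq_mul2l [leqRHS]expnS leq_mul2l leq_exp2r // le_t !orbT.
Qed.

End Divisors.

(** * Divisors of polynomial values *)

Section DivisorSums.

(** * Number of roots of an integer polynomial modulo m *)

Lemma horner_taylor2 (R : comNzRingType) (Q : {poly R}) (x h : R) :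
  exists s, Q.[x + h] = Q.[x] + Q^`().[x] * h + s * h ^+ 2.
Proof.
elim/poly_ind: Q => [|Q c [s IH]].
  by exists 0; rewrite deriv0 !horner0 !mul0r !addr0.
exists (Q^`().[x] + s * (x + h)).
by rewrite derivMXaddC !hornerMXaddC hornerD hornerMX IH; ring.
Qed.

Lemma dvdz_horner_sub (Q : {poly int}) (x y : int) : (x - y %| Q.[x] - Q.[y])%Z.
Proof.
have [s] := horner_taylor2 Q y (x - y); rewrite addrC subrK => ->.
by apply/dvdzP; exists (Q^`().[y] + s * (x - y)); ring.
Qed.

(** [N] bounds the number of roots of [Q] modulo [m]; a list of pairwise incongruent integers stands
    for a set of residue classes. *)
Definition root_bound (Q : {poly int}) (m N : nat) : Prop :=
  forall l : seq int, uniq [seq (x %% m)%Z | x <- l] ->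
    (forall x, x \in l -> (m %| Q.[x])%Z) -> (size l <= N)%N.

Lemma root_bound_modulus (Q : {poly int}) (m : nat) : (0 < m)%N -> root_bound Q m m.
Proof.
move=> m_gt0 l uniq_l _.
rewrite -[X in (_ <= X)%N](size_iota 0) -(size_map (fun x => (x %% m)%Z)).
rewrite -(size_map Posz); apply: uniq_leq_size uniq_l _ => _ /mapP[x _ ->].
have m_neq0 : m%:Z != 0 by rewrite -lt0n in m_gt0 *; case: m m_gt0.
have := modz_ge0 x m_neq0; have := ltz_pmod x (m_gt0 : 0 < m%:Z).
case: (x %% m)%Z => // n lt_n _; apply/mapP; exists n => //.
by rewrite mem_iota.
Qed.

Lemma map_uniq_inj_in (T1 T2 : eqType) (f : T1 -> T2) (s : seq T1) :
  uniq (map f s) -> {in s &, injective f}.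
Proof.
elim: s => // z s IHs /= /andP[z_s /IHs inj_s] x y; rewrite !inE.
case/predU1P => [->|x_s] /predU1P[->|y_s] // fxy.
- by rewrite fxy map_f in z_s.
- by rewrite -fxy map_f in z_s.
exact: inj_s.
Qed.

(** Chinese remainder theorem: a root modulo [a * b] is determined by its residues modulo [a] and
    [b], which are roots modulo [a] and [b]. *)
Lemma root_boundM (Q : {poly int}) (a b A B : nat) :
  coprime a b -> root_bound Q a A -> root_bound Q b B ->
  root_bound Q (a * b) (A * B).
Proof.
move=> co_ab bound_a bound_b l uniq_l root_l.
have bound (c C : nat) : (c %| a * b)%N -> root_bound Q c C ->
    (size (undup [seq (x %% c)%Z | x <- l]) <= C)%N.
  move=> c_ab; apply.
    rewrite map_inj_in_uniq ?undup_uniq // => x y.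
    rewrite !mem_undup => /mapP[x' _ ->] /mapP[y' _ ->].
    by rewrite !modz_mod.
  move=> x; rewrite mem_undup => /mapP[y /root_l root_y ->].
  have c_root : (c %| Q.[y])%Z by apply: dvdz_trans root_y.
  have c_mod : (c %| (y %% c)%Z - y)%Z by rewrite -eqz_mod_dvd modz_mod.
  rewrite -(subrK Q.[y] Q.[_]) rpredD //.
  exact: dvdz_trans c_mod (dvdz_horner_sub _ _ _).
apply: leq_trans (leq_mul (bound a A (dvdn_mulr _ (dvdnn _)) bound_a)
  (bound b B (dvdn_mull _ (dvdnn _)) bound_b)).
rewrite -(size_allpairs pair) -(size_map (fun x => ((x %% a)%Z, (x %% b)%Z))).
apply: uniq_leq_size; last first.
  by move=> _ /mapP[x x_l ->]; apply: allpairs_f; rewrite mem_undup; apply/mapP; exists x.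
rewrite map_inj_in_uniq; first by apply: map_uniq uniq_l.
move=> x y x_l y_l [/eqP]; rewrite eqz_mod_dvd => a_xy /eqP.
rewrite eqz_mod_dvd => b_xy; apply: (map_uniq_inj_in uniq_l) => //.
by apply/eqP; rewrite eqz_mod_dvd PoszM Gauss_dvdz ?a_xy.
Qed.

(* With h = x - y and p^(e+1) | h, Taylor's formula gives Q(x) - Q(y) = h w
   where w = Q'(y) mod p^(e+1), and v_p(w) <= e because D = u Q + v Q'. *)
Lemma root_separation (Q u v : {poly int}) (D : int) (p k : nat) (x y : int) :
  u * Q + v * Q^`() = D%:P -> D != 0 -> prime p ->
  let e := logn p `|D| in (e < k)%N ->
  ((p ^ k)%N %| Q.[x])%Z -> ((p ^ k)%N %| Q.[y])%Z ->
  ((p ^ e.+1)%N %| x - y)%Z -> ((p ^ (k - e))%N %| x - y)%Z.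
Proof.
move=> bezout D_neq0 p_pr e lt_ek root_x root_y h_dvd.
have [s taylor] := horner_taylor2 Q y (x - y); rewrite addrC subrK in taylor.
set h := x - y in taylor h_dvd *.
pose w := Q^`().[y] + s * h.
have hw : ((p ^ k)%N %| h * w)%Z.
  have -> : h * w = Q.[x] - Q.[y] by rewrite taylor /w; ring.
  by rewrite rpredB.
have w_ndvd : ~~ ((p ^ e.+1)%N %| w)%Z.
  apply/negP => w_dvd.
  have e_k : ((p ^ e.+1)%N %| Q.[y])%Z by apply: dvdz_trans root_y; apply: dvdn_exp2l.
  have : ((p ^ e.+1)%N %| D)%Z.
    have -> : D = u.[y] * Q.[y] + v.[y] * (w - s * h).
      by have := congr1 (horner^~ y) bezout; rewrite /w !hornerE => <-; ring.
    by rewrite rpredD ?dvdz_mull // rpredB ?dvdz_mull.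
  by rewrite dvdzE /= pfactor_dvdn ?absz_gt0 // -/e ltnn.
have [->|h_neq0] := eqVneq h 0; first by rewrite dvdz0.
have w_neq0 : w != 0 by apply: contraNneq w_ndvd => ->; rewrite dvdz0.
move: hw w_ndvd; rewrite !dvdzE /= abszM !pfactor_dvdn ?muln_gt0 ?absz_gt0 ?h_neq0 //.
rewrite lognM ?absz_gt0 // -leqNgt => le_k le_w.
by rewrite leq_subLR (leq_trans le_k) // addnC leq_add2r -ltnS.
Qed.

Lemma intr_Fp_eq0 (p : nat) (z : int) : prime p -> ((z%:~R : 'F_p) == 0) = (p %| z)%Z.
Proof.
move=> p_pr; rewrite dvdzE /= (dvdn_pcharf (pchar_Fp p_pr)).
by rewrite {1}[z]intEsign rmorphM rmorph_sign mulf_eq0 signr_eq0.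
Qed.

(** Reducing the Bezout identity modulo [p] shows that [Q] is nonzero over the field ['F_p], where
    its roots are fewer than its size. *)
Lemma root_bound_prime (Q u v : {poly int}) (D : int) (p : nat) :
  u * Q + v * Q^`() = D%:P -> prime p -> ~~ (p %| D)%Z -> root_bound Q p (size Q).
Proof.
move=> bezout p_pr p_D l uniq_l root_l.
pose f : {poly 'F_p} := map_poly intr Q.
have f_neq0 : f != 0.
  apply: contraNneq p_D => f0; rewrite -intr_Fp_eq0 //.
  have := congr1 (map_poly (intr : int -> 'F_p)) bezout.
  rewrite rmorphD !rmorphM /= -deriv_map -/f f0 deriv0 !mulr0 addr0 map_polyC /=.
  by move=> /eqP; rewrite eq_sym polyC_eq0.
have roots : all (root f) [seq (x%:~R : 'F_p) | x <- l].
  apply/allP => _ /mapP[x x_l ->].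
  by rewrite rootE /f horner_map /= intr_Fp_eq0 // root_l.
have uniq_roots : uniq [seq (x%:~R : 'F_p) | x <- l].
  rewrite map_inj_in_uniq; first exact: map_uniq uniq_l.
  move=> x y x_l y_l /eqP; rewrite -subr_eq0 -rmorphB intr_Fp_eq0 // => p_xy.
  by apply: (map_uniq_inj_in uniq_l) => //; apply/eqP; rewrite eqz_mod_dvd.
have := max_poly_roots f_neq0 roots uniq_roots; rewrite size_map => lt_l.
by apply: leq_trans (ltnW lt_l) _; exact: size_poly.
Qed.

(** The bound is independent of [p] and [k]. If [k <= e], the modulus itself is at most the absolute
    value of [D]. Otherwise roots in the same class modulo [p ^ e.+1] agree modulo [p ^ (k - e)] by
    [root_separation], so each class holds at most [p ^ e] roots. *)
Lemma root_bound_prime_power (Q u v : {poly int}) (D : int) (p k : nat) :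
  u * Q + v * Q^`() = D%:P -> D != 0 -> prime p ->
  root_bound Q (p ^ k) (maxn (size Q) (`|D| ^ 3)).
Proof.
move=> bezout D_neq0 p_pr l uniq_l root_l; set e := logn p `|D|.
have D_gt0 : (0 < `|D|)%N by rewrite absz_gt0.
have le_pe : (p ^ e <= `|D|)%N by rewrite dvdn_leq // pfactor_dvdnn.
have le_D3 : (`|D| <= `|D| ^ 3)%N by rewrite -[leqLHS]expn1 leq_pexp2l.
have [le_ke|lt_ek] := leqP k e.
  have pk_gt0 : (0 < p ^ k)%N by rewrite expn_gt0 prime_gt0.
  rewrite (leq_trans (root_bound_modulus pk_gt0 uniq_l root_l)) // leq_max.
  apply/orP; right; apply: leq_trans le_D3; apply: leq_trans le_pe.
  by rewrite leq_pexp2l ?prime_gt0.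
have root_dvd n x : (n <= k)%N -> x \in l -> ((p ^ n)%N %| Q.[x])%Z.
  by move=> le_n /root_l; apply: dvdz_trans; apply: dvdn_exp2l.
pose c := undup [seq (x %% (p ^ e.+1)%N)%Z | x <- l].
have c_uniq : uniq [seq (x %% (p ^ e.+1)%N)%Z | x <- c].
  rewrite map_inj_in_uniq ?undup_uniq // => x y.
  rewrite !mem_undup => /mapP[x' _ ->] /mapP[y' _ ->].
  by rewrite !modz_mod.
have c_root x : x \in c -> ((p ^ e.+1)%N %| Q.[x])%Z.
  rewrite mem_undup => /mapP[y y_l ->]; rewrite -(subrK Q.[y] Q.[_]) rpredD ?root_dvd //.
  by apply: dvdz_trans (dvdz_horner_sub _ _ _); rewrite -eqz_mod_dvd modz_mod.
(* If [p] divides [D] then [1 <= e], so [p ^ e.+1 * p ^ e] is at most the cube of [p ^ e]; otherwise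
   [e = 0] and the bound modulo a prime applies. *)
have size_c : (size c * p ^ e <= maxn (size Q) (`|D| ^ 3))%N.
  rewrite leq_max; have [p_D|p_D] := boolP (p %| D)%Z.
    apply/orP; right; have e_gt0 : (0 < e)%N.
      by rewrite /e logn_gt0 mem_primes p_pr D_gt0.
    rewrite expnSr leq_mul //; apply: (@leq_trans (p ^ e.+1)).
      by apply: root_bound_modulus c_root; rewrite // expn_gt0 prime_gt0.
    rewrite (@leq_trans ((p ^ e) ^ 2)) ?leq_exp2r // -expnM.
    by rewrite leq_pexp2l ?prime_gt0 // muln2 -addnn -addn1 leq_add2l.
  have e0 : e = 0%N.
    apply/eqP; rewrite -leqn0 leqNgt /e logn_gt0 mem_primes p_pr D_gt0.
    by rewrite dvdzE in p_D.
  rewrite e0 muln1 (root_bound_prime bezout p_pr p_D) //; by rewrite e0 expn1 in c_uniq c_root.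
apply: leq_trans size_c.
pose M := (p ^ (k - e))%N.
have M_gt0 : (0 < M)%N by rewrite expn_gt0 prime_gt0.
have pk : (p ^ k)%N = (M * p ^ e)%N by rewrite -expnD subnK // ltnW.
(* The second component takes at most [p ^ e] values. Roots with equal first components have the
   same residue modulo [M], so an equal quotient by [M] makes them congruent modulo [p ^ k]. *)
pose g x := ((x %% (p ^ e.+1)%N)%Z, ((x %% (p ^ k)%N)%Z %/ M)%Z).
rewrite -[X in (_ * X)%N](size_iota 0) -(size_map Posz) -(size_allpairs pair) -(size_map g).
apply: uniq_leq_size; last first.
  move=> _ /mapP[x x_l ->]; apply: allpairs_f.
    by rewrite mem_undup; apply/mapP; exists x.
  have pk_neq0 : (p ^ k)%N%:Z != 0 by rewrite -lt0n expn_gt0 prime_gt0.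
  have pk_gt0 : 0 < (p ^ k)%N%:Z by rewrite ltz_nat expn_gt0 prime_gt0.
  have := modz_ge0 x pk_neq0; have := ltz_pmod x pk_gt0.
  case: (x %% (p ^ k)%N)%Z => // n; rewrite ltz_nat pk mulnC => lt_n _.
  rewrite divz_nat map_f // mem_iota ltn_divLR //.
rewrite map_inj_in_uniq; first by apply: map_uniq uniq_l.
move=> x y x_l y_l [/eqP]; rewrite eqz_mod_dvd => xy_e xy_div.
have : (M %| x - y)%Z.
  by apply: (root_separation bezout D_neq0 p_pr lt_ek); rewrite ?root_l.
rewrite -eqz_mod_dvd => /eqP xy_M; apply: (map_uniq_inj_in uniq_l) => //.
have M_mod z : ((z %% (p ^ k)%N)%Z %% M)%Z = (z %% M)%Z.
  apply/eqP; rewrite eqz_mod_dvd; apply: dvdz_trans (_ : ((p ^ k)%N %| _)%Z).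
    by rewrite pk dvdzE /= dvdn_mulr.
  by rewrite -eqz_mod_dvd modz_mod.
by rewrite /= (divz_eq (x %% (p ^ k)%N)%Z M) (divz_eq (y %% (p ^ k)%N)%Z M) xy_div !M_mod xy_M.
Qed.

(** The bound [B] holds modulo every prime power, so splitting off a full prime power multiplies the
    number of roots by at most [B <= 2 ^ B], while the number of divisors at least doubles. *)
Lemma root_bound_divisors (Q u v : {poly int}) (D : int) :
  u * Q + v * Q^`() = D%:P -> D != 0 ->
  exists B : nat, forall m : nat, (0 < m)%N -> root_bound Q m (size (divisors m) ^ B).
Proof.
move=> bezout D_neq0; pose B := maxn (size Q) (`|D| ^ 3); exists B.
elim/ltn_ind => m IHm m_gt0.
have [m1|m_gt1] := leqP m 1.
  have -> : m = 1%N by lia.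
  move=> l uniq_l root_l; rewrite (leq_trans (root_bound_modulus _ uniq_l root_l)) //.
  by rewrite expn_gt0 size_divisors_gt0.
have p_pr := pdiv_prime m_gt1; set p := pdiv m in p_pr.
have [n n_p mE] := pfactor_coprime p_pr m_gt0.
have k_gt0 : (0 < logn p m)%N by rewrite logn_gt0 mem_primes p_pr m_gt0 pdiv_dvd.
set k := logn p m in mE k_gt0.
have n_gt0 : (0 < n)%N by case: n mE {n_p} m_gt0 => // ->.
have pk_gt1 : (1 < p ^ k)%N by rewrite -(exp1n k) ltn_exp2r ?prime_gt1.
have lt_nm : (n < m)%N by rewrite mE ltn_Pmulr.
have le_B : (B <= 2 ^ B)%N by apply: ltnW; apply: ltn_expl.
(* The divisors of [n] and their multiples by [p ^ k] are disjoint families of divisors of [m]. *)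
have tau_m : (2 * size (divisors n) <= size (divisors m))%N.
  rewrite mul2n -addnn -[X in (_ + X <= _)%N](size_map (muln (p ^ k))) -size_cat.
  apply: uniq_leq_size => [|e].
    rewrite cat_uniq divisors_uniq map_inj_uniq ?divisors_uniq ?andbT /=; last first.
      by move=> x y /eqP; rewrite eqn_pmul2l ?(ltnW pk_gt1) // => /eqP.
    apply/hasPn => _ /mapP[e _ ->]; rewrite -dvdn_divisors //; apply/negP => pe_n.
    have : (p ^ k %| n)%N by apply: dvdn_trans pe_n; apply: dvdn_mulr.
    move/gcdn_idPl; have /eqP -> : coprime (p ^ k) n by rewrite coprimeXl.
    by move=> pk1; rewrite -pk1 in pk_gt1.
  rewrite mem_cat -!dvdn_divisors // mE => /orP[e_n|/mapP[e' e'_n ->]].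
    exact: dvdn_mulr.
  by rewrite mulnC dvdn_pmul2r ?(ltnW pk_gt1) // dvdn_divisors.
have bound := root_boundM (coprimeXl k n_p) (root_bound_prime_power (k := k) bezout D_neq0 p_pr)
  (IHm n lt_nm n_gt0).
rewrite mulnC -mE in bound => l uniq_l root_l.
apply: leq_trans (bound l uniq_l root_l) _.
apply: (@leq_trans ((2 * size (divisors n)) ^ B)).
  by rewrite expnMn leq_mul2r le_B orbT.
have [->|B_gt0] := posnP B; first by rewrite !expn0.
by rewrite leq_exp2r.
Qed.

(** Cut the [M] consecutive integers into at most [q] blocks of length at most [d]; the integers of
    one block are pairwise incongruent modulo [d]. *)
Lemma count_roots_interval (Q : {poly int}) (d N t M q : nat) (s : int) :
  (0 < d)%N -> root_bound Q d N -> (M <= d * q)%N ->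
  (count (fun n : nat => d %| `|Q.[n%:Z + s]|) (iota t M) <= q * N)%N.
Proof.
move=> d_gt0 bound; elim: q t M => [|q IHq] t M.
  by rewrite muln0 leqn0 => /eqP ->.
rewrite mulnS => le_M; have min_M : (minn d M <= M)%N by rewrite geq_minr.
rewrite -(subnKC min_M) iotaD count_cat mulSn leq_add //; last first.
  by apply: IHq; rewrite leq_subLR; lia.
have -> : count (fun n : nat => d %| `|Q.[n%:Z + s]|)%N (iota t (minn d M)) =
    size [seq n%:Z + s | n <- iota t (minn d M) & (d %| `|Q.[n%:Z + s]|)%N].
  by rewrite size_map size_filter.
apply: bound => [|x /mapP[n]]; last first.
  by rewrite mem_filter => /andP[dvd_n _] ->.
rewrite -map_comp map_inj_in_uniq ?filter_uniq ?iota_uniq // => n1 n2.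
rewrite !mem_filter !mem_iota => /andP[_ n1_t] /andP[_ n2_t] /eqP.
rewrite /= eqz_mod_dvd opprD addrACA subrr addr0 dvdzE /= => d_n.
apply/eqP; rewrite -distn_eq0; apply: contraTT d_n; rewrite -lt0n => n_gt0.
apply/negP => /(dvdn_leq n_gt0); lia.
Qed.

(** By [size_divisors_le_small] each term is controlled by one divisor of the value that is at most
    [H]. Replace that divisor by the sum over all [d <= H], exchange the sums, and count the [n] for
    which [d] divides the value. *)
Lemma poly_sum_divisors_le (Q : {poly int}) (k l B H : nat) :
  (forall m, (0 < m)%N -> root_bound Q m (size (divisors m) ^ B)) ->
  (forall n, (n < (2 * H).+1)%N -> `|Q.[n%:Z - H%:Z]| < H ^ k.+1)%N ->
  (\sum_(0 <= n < (2 * H).+1 | Q.[n%:Z - H%:Z] != 0%R) tau Q.[n%:Z - H%:Z] ^ l <=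
   2 ^ (k * l) * \sum_(1 <= d < H.+1)
     size (divisors d) ^ (k.+1 * l + B) * (2 * H %/ d).+1)%N.
Proof.
move=> bound lt_Q.
apply: (@leq_trans (\sum_(0 <= n < (2 * H).+1) \sum_(1 <= d < H.+1)
    2 ^ (k * l) * ((d %| `|Q.[n%:Z - H%:Z]|) * size (divisors d) ^ (k.+1 * l)))%N).
  rewrite big_mkcond big_nat [leqRHS]big_nat; apply: leq_sum => n /andP[_ lt_n].
  case: ifP => // Q_neq0; have m_gt0 : (0 < `|Q.[n%:Z - H%:Z]|)%N by rewrite absz_gt0.
  have [e /andP[e_m le_eH] le_tau] := size_divisors_le_small m_gt0 (lt_Q n lt_n).
  have e_gt0 := dvdn_gt0 m_gt0 e_m.
  rewrite (big_rem e) ?mem_index_iota ?e_gt0 //= e_m mul1n.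
  apply: leq_trans (leq_addr _ _).
  rewrite !expnM -expnMn; have [->|l_gt0] := posnP l; first by rewrite !expn0.
  by rewrite leq_exp2r.
rewrite exchange_big /= big_distrr /= big_nat [leqRHS]big_nat.
apply: leq_sum => d /andP[d_gt0 le_d]; rewrite -big_distrr leq_mul2l /=.
apply/orP; right; rewrite -big_distrl /= expnD mulnC -mulnA leq_mul2l; apply/orP; right.
have -> : (\sum_(0 <= n < (2 * H).+1) (d %| `|Q.[n%:Z - H%:Z]|) =
    count (fun n : nat => d %| `|Q.[n%:Z - H%:Z]|) (iota 0 (2 * H).+1))%N.
  rewrite -sum1_count [RHS]big_mkcond /index_iota subn0; apply: eq_bigr => n _.
  by case: ifP.
rewrite [leqRHS]mulnC; apply: count_roots_interval (bound d d_gt0) _ => //.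
by rewrite [leqRHS]mulnC -ltn_divLR.
Qed.

(** * Harmonic sums weighted by powers of the divisor function, and moments of the divisor function
    at polynomial values *)

Definition divisor_sum (R : realFieldType) (B H : nat) : R :=
  \sum_(1 <= d < H.+1) (size (divisors d))%:R ^+ B / d%:R.

Lemma divisor_sum_ge0 (R : realFieldType) (B H : nat) : 0 <= divisor_sum R B H.
Proof. by apply: sumr_ge0 => d _; rewrite divr_ge0 ?exprn_ge0. Qed.

(* tau(d) counts the factorizations d = a b, and tau(a b) <= tau a * tau b. *)
Lemma divisor_sumS (R : realFieldType) (B H : nat) :
  divisor_sum R B.+1 H <= divisor_sum R B H ^+ 2.
Proof.
pose G n : R := (size (divisors n))%:R ^+ B / n%:R.
have G_ge0 n : 0 <= G n by rewrite divr_ge0 ?exprn_ge0.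
have -> : divisor_sum R B H ^+ 2 =
    \sum_(1 <= a < H.+1) \sum_(1 <= b < H.+1) G a * G b.
  rewrite expr2 mulr_suml; apply: eq_bigr => a _.
  by rewrite mulr_sumr.
apply: (@le_trans _ _ (\sum_(1 <= d < H.+1) \sum_(1 <= a < H.+1) \sum_(1 <= b < H.+1)
    (a * b == d)%N%:R * (G a * G b))).
  rewrite /divisor_sum big_nat [leRHS]big_nat; apply: ler_sum => d /andP[d_gt0 le_d].
  have tauE : (size (divisors d))%:R =
      \sum_(1 <= a < H.+1) (a %| d)%N%:R :> R.
    rewrite -natr_sum; congr _%:R; rewrite -big_mkcond sum1_count -size_filter.
    apply: perm_size; apply: uniq_perm; rewrite ?divisors_uniq ?filter_uniq ?iota_uniq // => a.
    rewrite mem_filter mem_index_iota -dvdn_divisors //.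
    apply/idP/idP => [a_d|/andP[]//]; rewrite a_d (dvdn_gt0 d_gt0 a_d).
    by rewrite (leq_ltn_trans (dvdn_leq d_gt0 a_d)).
  rewrite exprS -mulrA [X in X * _]tauE mulr_suml big_nat [leRHS]big_nat.
  apply: ler_sum => a /andP[a_gt0 _].
  have [a_d|_] := boolP (a %| d)%N; last first.
    by rewrite mul0r; apply: sumr_ge0 => b _; rewrite mulr_ge0 ?ler0n // mulr_ge0.
  have dE : (d = a * (d %/ a))%N by rewrite mulnC divnK.
  have b_gt0 : (0 < d %/ a)%N by rewrite divn_gt0 // dvdn_leq.
  rewrite (big_rem (d %/ a)%N) /=; last first.
    by rewrite mem_index_iota b_gt0 (leq_ltn_trans (leq_div _ _)).
  rewrite -dE eqxx !mul1r -[leLHS]addr0 lerD //; last first.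
    by apply: sumr_ge0 => b _; rewrite mulr_ge0 ?ler0n // mulr_ge0.
  rewrite /G mulrACA -invfM -natrM -dE ler_wpM2r ?invr_ge0 // -exprMn -natrM.
  by rewrite lerXn2r ?nnegrE // ler_nat {1}dE size_divisorsM.
rewrite exchange_big /=; apply: ler_sum => a _.
rewrite exchange_big /=; apply: ler_sum => b _.
rewrite -mulr_suml -[leRHS]mul1r; apply: ler_wpM2r; first exact: mulr_ge0.
rewrite -natr_sum lern1 -big_mkcond sum1_count.
rewrite (@eq_count _ _ (pred1 (a * b)%N)) => [|n]; last by rewrite /= eq_sym.
by rewrite count_uniq_mem ?iota_uniq // leq_b1.
Qed.

(** Each of the [B] steps down to the harmonic sum costs one squaring. *)
Lemma divisor_sum_le (R : realFieldType) (B H : nat) :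
  divisor_sum R B H <= divisor_sum R 0 H ^+ (2 ^ B).
Proof.
elim: B => [|B IHB]; first by rewrite expr1.
apply: le_trans (divisor_sumS _ _ _) _.
by rewrite expnSr exprM lerXn2r ?nnegrE ?exprn_ge0 ?divisor_sum_ge0.
Qed.

(** From [5 / 6 <= expR (- 6^-1)] one gets that e is at most the sixth power of 6/5, which is less
    than 3. *)
Lemma ln3_gt1 (R : realType) : 1 < ln 3 :> R.
Proof.
have e_le : expR (6^-1 : R) <= 6 / 5.
  have := expR_ge1Dx (- 6^-1 : R); rewrite expRN => le_inv.
  rewrite -[leLHS]invrK -[leRHS]invrK lef_pV2 ?posrE ?invr_gt0 ?expR_gt0 //; lra.
rewrite -[ltLHS](expRK 1) ltr_ln ?posrE ?expR_gt0 //.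
have -> : expR 1 = expR (6^-1) ^+ 6 :> R.
  by rewrite -expRM_natl; congr expR; lra.
apply: (@le_lt_trans _ _ ((6 / 5) ^+ 6)); last by lra.
by rewrite lerXn2r ?nnegrE ?expR_ge0.
Qed.

Lemma ln_gt1 (R : realType) (H : nat) : (3 <= H)%N -> 1 < ln H%:R :> R.
Proof.
move=> H_ge3; apply: lt_le_trans (ln3_gt1 R) _.
by rewrite ler_ln ?posrE ?ltr0n ?ler_nat // (leq_trans _ H_ge3).
Qed.

(** Telescoping: [ln (1 - 1 / n) <= - (1 / n)] bounds [1 / n] by the increment of [ln] from [n - 1]
    to [n]. *)
Lemma divisor_sum0_le (R : realType) (H : nat) :
  (0 < H)%N -> divisor_sum R 0 H <= 1 + ln H%:R.
Proof.
rewrite /divisor_sum; elim: H => // -[_ _|H IHH _].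
  by rewrite big_nat1 expr0 divr1 ln1 addr0.
rewrite big_nat_recr //= expr0 div1r.
apply: (@le_trans _ _ (1 + ln H.+1%:R + H.+2%:R^-1)); first by rewrite lerD2r IHH.
rewrite -addrA lerD2l.
have : ln (1 + - (H.+2%:R^-1)) <= - (H.+2%:R^-1 : R).
  by apply: le_ln1Dx; rewrite ltrN2 invf_lt1 ?ltr1n.
have -> : 1 - H.+2%:R^-1 = H.+1%:R / H.+2%:R :> R.
  by rewrite -(natr1 H.+1); field; rewrite nat1r natr1 pnatr_eq0.
rewrite lnM ?posrE ?invr_gt0 ?ltr0n // lnV ?posrE ?ltr0n //.
by rewrite lerBlDr -lerBrDr [- _ + _]addrC.
Qed.

(** Powers of [ln 3 > 1] are unbounded by Bernoulli's inequality. This is how constant factors are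
    absorbed into the exponent of log H. *)
Lemma exprn_absorb (R : realType) (c : R) : exists e : nat,
  forall x : R, ln 3 <= x -> c <= x ^+ e.
Proof.
have ln3 := ln3_gt1 R; set y := ln 3 in ln3 *.
have y_gt0 : 0 < y - 1 by rewrite subr_gt0.
pose e := Num.truncn (`|c| / (y - 1)); exists e.+1 => x le_yx.
have bern n : 1 + n%:R * (y - 1) <= y ^+ n.
  elim: n => [|n IHn]; first by rewrite mul0r addr0.
  rewrite exprS; apply: le_trans (ler_wpM2l (ltW (lt_trans ltr01 ln3)) IHn).
  rewrite -natr1 -subr_ge0.
  suff -> : y * (1 + n%:R * (y - 1)) - (1 + (n%:R + 1) * (y - 1)) = n%:R * (y - 1) ^+ 2.
    by rewrite mulr_ge0 ?sqr_ge0.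
  ring.
apply: (@le_trans _ _ (y ^+ e.+1)); last by rewrite lerXn2r ?nnegrE //; lra.
apply: le_trans (bern _); apply: (le_trans (ler_norm c)).
have : `|c| / (y - 1) < e.+1%:R by apply: truncnS_gt.
rewrite ltr_pdivrMr //; lra.
Qed.

Lemma horner_bound (Q : {poly int}) : exists k : nat, forall (H : nat) (x : int),
  (3 <= H)%N -> (`|x| <= H)%N -> (`|Q.[x]| < H ^ k.+1)%N.
Proof.
(* The sum [K] of the absolute values of the coefficients is itself absorbed through
   [K < H ^ K.+1]. *)
pose K := (\sum_(i < size Q) `|(Q`_i)%R|)%N; exists (K + size Q)%N => H x H_ge3 le_x.
have H_gt0 : (0 < H)%N by apply: leq_trans H_ge3.
have le_Q : (`|Q.[x]| <= K * H ^ size Q)%N.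
  rewrite horner_coef /K big_distrl /=.
  elim/big_ind2: _ => // [a u b v le_u le_v|i _].
    have := leqD_dist u 0 (- v); rewrite !opprK subr0 add0r => /leq_trans; apply.
    exact: leq_add.
  rewrite abszM abszX leq_mul //.
  apply: (@leq_trans (H ^ i)); first by case: (nat_of_ord i) => // n; rewrite leq_exp2r.
  by rewrite leq_pexp2l // ltnW.
apply: (leq_ltn_trans le_Q); rewrite -addSn expnD ltn_mul2r expn_gt0 H_gt0 /=.
by apply: ltn_trans (_ : K < K.+1)%N _ => //; apply: ltn_expl; apply: leq_trans H_ge3.
Qed.

(** Coprimality gives the Bezout identity that controls the roots modulo every [m]; the mean then
    reduces to a weighted harmonic sum, which is at most a power of [1 + ln H]. *)
Lemma sum_tau_power_coprime (R : realType) (Q : {poly int}) (l : nat) :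
  coprimep Q Q^`() -> exists C : nat, forall H : nat, (3 <= H)%N ->
  \sum_(0 <= n < (2 * H).+1 | Q.[n%:Z - H%:Z] != 0) (tau Q.[n%:Z - H%:Z])%:R ^+ l
    <= H%:R * ln H%:R ^+ C :> R.
Proof.
move=> /Bezout_coprimepP[[u v] /= /eqpP[[c1 c2] /= /andP[_ c2_neq0] bezout]].
(* Over the integers the Bezout combination is only associated to 1 up to nonzero scalars; clearing
   them leaves the constant [c2], which plays the role of [D]. *)
have {}bezout : (c1 *: u) * Q + (c1 *: v) * Q^`() = c2%:P.
  by rewrite -!scalerAl -scalerDr bezout alg_polyC.
have [B bound] := root_bound_divisors bezout c2_neq0.
have [k lt_Q] := horner_bound Q.
(* [A] adds the exponent of the divisor bound to that of the root count. In the constant absorbed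
   next, 3 comes from [2 * H %/ d + 1 <= 3 * H / d] and [2 ^+ E] from [1 + ln H <= 2 * ln H]. *)
pose A := (k.+1 * l + B)%N; pose E := (2 ^ A)%N.
have [e le_e] := exprn_absorb (2 ^+ (k * l) * 3 * 2 ^+ E : R).
exists (e + E)%N => H H_ge3; have H_gt0 : (0 < H)%N by apply: leq_trans H_ge3.
have lt_Q' n : (n < (2 * H).+1)%N -> (`|Q.[n%:Z - H%:Z]| < H ^ k.+1)%N.
  by move=> lt_n; apply: lt_Q => //; lia.
have := poly_sum_divisors_le l bound lt_Q'; rewrite -(ler_nat R) natr_sum.
under eq_bigr do rewrite natrX.
move/le_trans; apply; rewrite natrM natrX natr_sum.
have lnH := ln_gt1 R H_ge3.
apply: (@le_trans _ _ (2 ^+ (k * l) * (3 * H%:R * divisor_sum R A H))).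
  rewrite ler_wpM2l ?exprn_ge0 // /divisor_sum mulr_sumr.
  rewrite big_nat [leRHS]big_nat; apply: ler_sum => d /andP[d_gt0 le_d].
  rewrite natrM natrX [leRHS]mulrCA ler_wpM2l ?exprn_ge0 // ler_pdivlMr ?ltr0n //.
  rewrite -!natrM ler_nat mulSn -[X in (_ <= X)%N]/(H + 2 * H)%N.
  by rewrite leq_add ?leq_divM.
have le_S : divisor_sum R A H <= (2 * ln H%:R) ^+ E.
  apply: le_trans (divisor_sum_le _ _ _) _.
  rewrite lerXn2r ?nnegrE ?divisor_sum_ge0 //; first by rewrite mulr_ge0 // ltW // (lt_trans ltr01).
  by apply: le_trans (divisor_sum0_le R H_gt0) _; lra.
have ln3_le : ln 3 <= ln H%:R :> R by rewrite ler_ln ?posrE ?ltr0n ?ler_nat.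
apply: (@le_trans _ _ (H%:R * (2 ^+ (k * l) * 3 * 2 ^+ E * ln H%:R ^+ E))).
  have -> : H%:R * (2 ^+ (k * l) * 3 * 2 ^+ E * ln H%:R ^+ E) =
      2 ^+ (k * l) * (3 * H%:R * (2 * ln H%:R) ^+ E) :> R by rewrite exprMn; ring.
  by rewrite ler_wpM2l ?exprn_ge0 // ler_wpM2l ?mulr_ge0.
rewrite ler_wpM2l // exprD ler_wpM2r ?le_e // exprn_ge0 // ltW // (lt_trans ltr01) //.
Qed.

(** Induction on the size: if [P] and its derivative share a factor, a multiple of [P] splits as
    [S * G] with both factors smaller. Then [y * z <= y ^+ 2 + z ^+ 2] separates the factors at the
    price of doubling [l], which is why all powers are treated together. *)
Lemma sum_tau_power_le (R : realType) (P : {poly int}) (l : nat) :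
  P != 0 -> exists C : nat, forall H : nat, (3 <= H)%N ->
  \sum_(0 <= n < (2 * H).+1 | P.[n%:Z - H%:Z] != 0) (tau P.[n%:Z - H%:Z])%:R ^+ l
    <= H%:R * ln H%:R ^+ C :> R.
Proof.
have [N] := ubnP (size P); elim: N P l => // N IHN P l /ltnSE size_P P_neq0.
(* Nonzero constants fall in the coprime case, their derivative being 0 and the gcd constant. *)
have [/sum_tau_power_coprime|nco] := boolP (coprimep P P^`()); first exact.
set G := gcdp P P^`() in nco *.
have size_G : (1 < size G)%N.
  rewrite ltn_neqAle lt0n size_poly_eq0 gcdp_eq0 (negPf P_neq0) andbT.
  by rewrite eq_sym.
have le_G : (size G <= size P)%N by rewrite dvdp_leq // dvdp_gcdl.
have P'_neq0 : P^`() != 0.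
  case sP : (size P) (leq_trans size_G le_G) => [|[|s]] // _.
  apply/eqP => /(congr1 (coefp s)) /eqP; rewrite /coefp coef_deriv coef0 mulrn_eq0 /=.
  by rewrite -[s.+1]/(s.+2.-1) -sP -lead_coefE lead_coef_eq0 (negPf P_neq0).
have lt_G : (size G < size P)%N.
  by apply: leq_ltn_trans (lt_size_deriv P_neq0); rewrite dvdp_leq // dvdp_gcdr.
have /Pdiv.WeakIdomain.dvdpP[[c S] /= c_neq0 PE] := dvdp_gcdl P P^`(); rewrite -/G in PE.
have SG_neq0 : S * G != 0 by rewrite -PE -mul_polyC mulf_neq0 ?polyC_eq0.
have /andP[S_neq0 G_neq0] : (S != 0) && (G != 0) by rewrite -negb_or -mulf_eq0.
have lt_S : (size S < size P)%N.
  by rewrite -(size_scale P c_neq0) PE size_mul // -subn1 ltn_subRL addnC; lia.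
have [C1 le_S] := IHN S (2 * l)%N (leq_trans lt_S size_P) S_neq0.
have [C2 le_G2] := IHN G (2 * l)%N (leq_trans lt_G size_P) G_neq0.
have [e le_e] := exprn_absorb (2 : R).
exists (e + (C1 + C2))%N => H H_ge3.
have lnH := ln_gt1 R H_ge3.
have lnH_ge0 : 0 <= ln H%:R :> R by rewrite ltW // (lt_trans ltr01).
have ln3_le : ln 3 <= ln H%:R :> R.
  by rewrite ler_ln ?posrE ?ltr0n ?ler_nat // (leq_trans _ H_ge3).
have := lerD (le_S H H_ge3) (le_G2 H H_ge3).
rewrite -mulrDr => le_sum.
apply: (@le_trans _ _ (H%:R * (ln H%:R ^+ C1 + ln H%:R ^+ C2))); last first.
  rewrite ler_wpM2l // exprD; apply: le_trans (ler_wpM2r _ (le_e _ ln3_le)); last exact: exprn_ge0.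
  by rewrite mulr_natl mulr2n lerD // ler_weXn2l ?ltW // ?leq_addr ?leq_addl.
apply: le_trans le_sum.
rewrite [leLHS]big_mkcond [X in X + _]big_mkcond [X in _ + X]big_mkcond.
rewrite -big_split /=; apply: ler_sum => n _.
set x := n%:Z - H%:Z.
have PxE : c * P.[x] = S.[x] * G.[x] by rewrite -hornerM -PE hornerZ.
have term_ge0 (b : bool) (z : int) : 0 <= (if b then (tau z)%:R ^+ (2 * l) else 0 : R).
  by case: b; rewrite ?exprn_ge0.
case: ifP => [Px_neq0|_]; last by rewrite addr_ge0.
have : S.[x] * G.[x] != 0 by rewrite -PxE mulf_neq0.
rewrite mulf_eq0 negb_or => /andP[Sx_neq0 Gx_neq0]; rewrite Sx_neq0 Gx_neq0.
(* The scalar [c] is harmless: the value of [P] divides [c] times itself, which is the product of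
   the values of [S] and [G]. *)
have le_tau : (tau P.[x] <= tau S.[x] * tau G.[x])%N.
  rewrite /tau; apply: leq_trans (size_divisorsM _ _); rewrite ?absz_gt0 //.
  by rewrite -abszM -PxE abszM dvdn_size_divisors ?dvdn_mull // muln_gt0 !absz_gt0 c_neq0.
apply: (@le_trans _ _ ((tau S.[x])%:R ^+ l * (tau G.[x])%:R ^+ l)).
  by rewrite -exprMn -natrM lerXn2r ?nnegrE ?ler_nat.
rewrite !(mulnC 2) !exprM; move: (_ ^+ l) (_ ^+ l) => y z.
by have := sqr_ge0 (y - z); have := sqr_ge0 (y + z); nra.
Qed.

End DivisorSums.

(** * Schwartz-Zippel for product weights *)

Section ProductWeight.

Definition update (I : finType) (V : Type) (u : {ffun I -> V}) (i : I) (x : V) :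
  {ffun I -> V} := [ffun j => if j == i then x else u j].

(** When each [p i] is a probability vector, this is the probability of [A] under the product
    law. *)
Definition product_weight (R : comPzSemiRingType) (I V : finType) (p : I -> V -> R)
  (A : {set {ffun I -> V}}) : R := \sum_(u in A) \prod_i p i (u i).

Lemma product_weightU (R : numDomainType) (I V : finType) (p : I -> V -> R)
    (A B : {set {ffun I -> V}}) :
  (forall i x, 0 <= p i x) ->
  product_weight p (A :|: B) <= product_weight p A + product_weight p B.
Proof.
move=> p_ge0; rewrite /product_weight.
have w_ge0 (u : {ffun I -> V}) : 0 <= \prod_i p i (u i) by apply: prodr_ge0.
rewrite (big_setID A) /= finset.setUK finset.setDUl finset.setDv finset.set0U lerD2l.
rewrite [leRHS](big_setID A) /= lerDr.
exact: sumr_ge0.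
Qed.

Lemma product_weightS (R : numDomainType) (I V : finType) (p : I -> V -> R)
    (A B : {set {ffun I -> V}}) :
  (forall i x, 0 <= p i x) -> A \subset B -> product_weight p A <= product_weight p B.
Proof.
move=> p_ge0 sAB; rewrite /product_weight [leRHS](big_setID A) /= (finset.setIidPr sAB) lerDl.
by apply: sumr_ge0 => u _; apply: prodr_ge0.
Qed.

Lemma product_weight_bigcup (R : numDomainType) (I V : finType) (p : I -> V -> R)
    (J : eqType) (s : seq J) (A : J -> {set {ffun I -> V}}) (K : R) :
  (forall i x, 0 <= p i x) -> (forall j, product_weight p (A j) <= K) ->
  product_weight p (\bigcup_(j <- s) A j) <= (size s)%:R * K.
Proof.
move=> p_ge0 le_K; elim: s => [|j s IHs].
  by rewrite big_nil mul0r /product_weight big_set0.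
rewrite big_cons; apply: le_trans (product_weightU _ _ p_ge0) _.
by rewrite /= -nat1r mulrDl mul1r lerD.
Qed.

(* Resampling coordinate i: the involution (u, x) |-> (u[i := x], u i)
   preserves the weight of the pair (u, x). *)
Lemma product_weight_resample (R : numDomainType) (I V : finType) (p : I -> V -> R)
    (A : {set {ffun I -> V}}) (i : I) (K : R) :
  (forall j x, 0 <= p j x) -> (forall j, \sum_x p j x = 1) ->
  (forall u, \sum_(x | update u i x \in A) p i x <= K) ->
  product_weight p A <= K.
Proof.
move=> p_ge0 p_sum le_K; rewrite /product_weight.
pose w (u : {ffun I -> V}) := \prod_j p j (u j).
pose W (ux : {ffun I -> V} * V) := p i ux.2 * w ux.1.
pose swap (ux : {ffun I -> V} * V) := (update ux.1 i ux.2, ux.1 i).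
have swapK : involutive swap.
  move=> [u x]; rewrite /swap /=; congr (_, _); last by rewrite ffunE eqxx.
  by apply/ffunP => j; rewrite !ffunE; case: eqP => // ->.
have WE ux : W (swap ux) = W ux.
  case: ux => u x; rewrite /W /swap /w /=.
  rewrite [in LHS](bigD1 i) //= [in RHS](bigD1 i) //= ffunE eqxx mulrCA.
  congr (_ * (_ * _)); apply: eq_bigr => j /negPf j_i; by rewrite ffunE j_i.
have sum_w : \sum_u w u = 1.
  by rewrite -(bigA_distr_bigA p) /= big1.
have -> : \sum_(u in A) w u = \sum_(ux : {ffun I -> V} * V | ux.1 \in A) W ux.
  transitivity (\sum_(u in A) \sum_x p i x * w u).
    by apply: eq_bigr => u _; rewrite -mulr_suml p_sum mul1r.
  by rewrite pair_big; apply: eq_bigl => ux; rewrite andbT.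
rewrite (reindex_inj (inv_inj swapK)) /=.
under eq_bigr do rewrite WE.
rewrite -(pair_big_dep xpredT (fun u x => update u i x \in A) (fun u x => p i x * w u)) /=.
apply: (@le_trans _ _ (\sum_u K * w u)); last by rewrite -mulr_sumr sum_w mulr1.
apply: ler_sum => u _; rewrite -mulr_suml ler_wpM2r // prodr_ge0 //.
Qed.

(** * Separating the last variable of a multivariate polynomial, as [muni] does *)

Definition mnm_rcons (n : nat) (m : multinom n) (e : nat) : multinom n.+1 :=
  Multinom [tuple of rcons (multinom_val m) e].

Lemma mnm_rcons_max n (m : multinom n) e : mnm_rcons m e ord_max = e.
Proof.
by rewrite (mnm_nth 0%N) /= nth_rcons size_tuple ltnn eqxx.
Qed.

Lemma mnm_rcons_widen n (m : multinom n) e (i : 'I_n) :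
  mnm_rcons m e (widen_ord (leqnSn n) i) = m i.
Proof. by rewrite !(mnm_nth 0%N) /= nth_rcons size_tuple ltn_ord. Qed.

Lemma mdeg_mnm_rcons n (m : multinom n) e : mdeg (mnm_rcons m e) = (mdeg m + e)%N.
Proof.
rewrite !mdegE big_ord_recr /= mnm_rcons_max; congr (_ + _)%N.
by apply: eq_bigr => i _; rewrite mnm_rcons_widen.
Qed.

Lemma mnm_rconsP n (m : multinom n.+1) :
  m = mnm_rcons (Multinom [tuple m (widen_ord (leqnSn n) i) | i < n]) (m ord_max).
Proof.
apply/mnmP => i; have [j ->|->] := unliftP ord_max i; last by rewrite mnm_rcons_max.
have -> : lift ord_max j = widen_ord (leqnSn n) j.
  by apply: val_inj; rewrite /= /bump leqNgt ltn_ord.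
by rewrite mnm_rcons_widen mnmE.
Qed.

Lemma mcoeff_muni (R : nzRingType) (n : nat) (G : mpoly n.+1 R) (e : nat) (m : multinom n) :
  mcoeff m (muni G)`_e = mcoeff (mnm_rcons m e) G.
Proof.
rewrite muniE coef_sum raddf_sum /=.
have termE (m1 : multinom n.+1) : mcoeff m (mcoeff m1 G *:
    mpolyX R (Multinom [tuple m1 (widen_ord (leqnSn n) i) | i < n]) *: 'X^(m1 ord_max))`_e
    = if m1 == mnm_rcons m e then mcoeff m1 G else 0.
  rewrite coefZ coefXn; have [->|m1_neq] := eqVneq m1 (mnm_rcons m e).
    rewrite mnm_rcons_max eqxx mulr1 mcoeffZ mcoeffX.
    rewrite (_ : Multinom _ = m) ?eqxx ?mulr1 //.
    by apply/mnmP => i; rewrite mnmE mnm_rcons_widen.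
  case: eqP => [eE|_]; last by rewrite mulr0 mcoeff0.
  rewrite mulr1 mcoeffZ mcoeffX; case: eqP => [mE|_]; last by rewrite mulr0.
  by rewrite eE -mE -mnm_rconsP eqxx in m1_neq.
under eq_bigr do rewrite termE.
have [m_G|m_G] := boolP (mnm_rcons m e \in msupp G).
  by rewrite (bigD1_seq (mnm_rcons m e)) //= eqxx big1 ?addr0 // => m1 /negPf ->.
rewrite [RHS]memN_msupp_eq0 // big_seq big1 // => m1 m1_G.
by case: eqP => // m1E; rewrite -m1E m1_G in m_G.
Qed.

Lemma meval_muni (R : comNzRingType) (n : nat) (G : mpoly n.+1 R) (v : 'I_n.+1 -> R) :
  meval v G = (map_poly (meval (fun i => v (widen_ord (leqnSn n) i))) (muni G)).[v ord_max].
Proof.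
rewrite muniE rmorph_sum horner_sum; apply: eq_bigr => m _.
rewrite /= map_polyZ /= map_polyXn hornerZ hornerXn /= mevalZ mevalX.
rewrite /mmap1 big_ord_recr /= mulrA; congr (_ * _ * _).
by apply: eq_bigr => i _; rewrite mnmE.
Qed.

Lemma eq_meval (R : nzRingType) (n : nat) (v1 v2 : 'I_n -> R) (G : mpoly n R) :
  v1 =1 v2 -> meval v1 G = meval v2 G.
Proof.
move=> eq_v; rewrite /meval /mmap; apply: eq_bigr => m _.
by congr (_ * _); apply: eq_bigr => i _; rewrite eq_v.
Qed.

Lemma size_muni_le (R : nzRingType) (n : nat) (G : mpoly n.+1 R) (L : nat) :
  degree_le L G -> (size (muni G) <= L.+1)%N.
Proof.
move=> le_L; apply/leq_sizeP => e lt_e; apply/mpolyP => m.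
rewrite mcoeff_muni mcoeff0 memN_msupp_eq0 //; apply: msize_mdeg_ge.
by rewrite mdeg_mnm_rcons (leq_trans le_L) // (leq_trans lt_e) ?leq_addl.
Qed.

Lemma degree_le_coef_muni (R : nzRingType) (n : nat) (G : mpoly n.+1 R) (L e : nat) :
  degree_le L G -> degree_le L (muni G)`_e.
Proof.
move=> le_L; rewrite /degree_le msizeE; apply/bigmax_leqP_seq => m m_G _.
rewrite mcoeff_msupp mcoeff_muni -mcoeff_msupp in m_G.
rewrite (leq_trans _ (leq_trans (msize_mdeg_lt m_G) le_L)) //.
by rewrite mdeg_mnm_rcons ltnS leq_addr.
Qed.

Lemma muni_neq0 (R : nzRingType) (n : nat) (G : mpoly n.+1 R) : G != 0 -> muni G != 0.
Proof.
apply: contra_neq => G0; apply/mpolyP => m.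
by rewrite (mnm_rconsP m) -mcoeff_muni G0 coef0 !mcoeff0.
Qed.

Lemma size_muni_gt1 (R : nzRingType) (n : nat) (G : mpoly n.+1 R) :
  (0 < degree_in ord_max G)%N -> (1 < size (muni G))%N.
Proof.
rewrite !ltnNge; apply: contra => size_le1.
apply/bigmax_leqP_seq => m m_G _; rewrite leqn0; apply: contraLR m_G => m_neq0.
rewrite mcoeff_msupp negbK (mnm_rconsP m) -mcoeff_muni nth_default ?mcoeff0 //.
by rewrite (leq_trans size_le1) // lt0n.
Qed.

Lemma meval_nvar0 (R : comNzRingType) (G : mpoly 0 R) (v : 'I_0 -> R) :
  G != 0 -> meval v G != 0.
Proof.
by rewrite [G]nvar0_mpolyC mevalC mpolyC_eq0.
Qed.

Lemma card_root_preim_le (F : idomainType) (V : finType) (point : V -> F) (f : {poly F}) :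
  injective point -> f != 0 -> (#|[set x | root f (point x)]| < size f)%N.
Proof.
move=> point_inj f_neq0; rewrite cardE -(size_map point).
apply: max_poly_roots => //; last by rewrite map_inj_uniq ?enum_uniq.
by apply/allP => _ /mapP[x + ->]; rewrite mem_enum inE.
Qed.

Lemma update_neq (I : finType) (V : Type) (u : {ffun I -> V}) (i j : I) (x : V) :
  j != i -> update u i x j = u j.
Proof. by move=> /negPf j_i; rewrite ffunE j_i. Qed.

(** Induction on the number of variables: either the leading coefficient in the last variable
    vanishes, or resampling the last coordinate must hit one of at most [N] roots, of total weight
    at most [K]. The map [emb] names the coordinates that [G] uses, so that the weight stays on all
    [m] coordinates throughout. *)
Lemma schwartz_zippel_weight (R : numFieldType) (m : nat) (V : finType) (point : V -> R)
    (p : 'I_m -> V -> R) (N : nat) (K : R) (k : nat) (emb : 'I_k -> 'I_m) (G : mpoly k R) :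
  injective point -> (forall i x, 0 <= p i x) -> (forall i, \sum_x p i x = 1) ->
  (forall i (X : {set V}), (#|X| <= N)%N -> \sum_(x in X) p i x <= K) ->
  injective emb -> G != 0 -> degree_le N G ->
  product_weight p [set u : {ffun 'I_m -> V} | meval (fun j => point (u (emb j))) G == 0]
    <= k%:R * K.
Proof.
move=> point_inj p_ge0 p_sum le_K.
elim: k emb G => [|k IHk] emb G emb_inj G_neq0 le_N.
  rewrite mul0r /product_weight big1 // => u; rewrite inE.
  by rewrite (negPf (meval_nvar0 _ G_neq0)).
pose g := lead_coef (muni G); pose emb' j := emb (widen_ord (leqnSn k) j).
have g_neq0 : g != 0 by rewrite lead_coef_eq0 muni_neq0.
have emb'_inj : injective emb'.
  by move=> j1 j2 /emb_inj /(congr1 val) /= /val_inj.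
have g_le_N : degree_le N g by apply: degree_le_coef_muni.
set i := emb ord_max.
have emb'_i j : emb' j != i.
  by apply/eqP => /emb_inj /(congr1 val) /= j_k; have := ltn_ord j; rewrite j_k ltnn.
pose A1 : {set {ffun 'I_m -> V}} :=
  [set u : {ffun 'I_m -> V} | meval (fun j => point (u (emb' j))) g == 0].
pose A2 : {set {ffun 'I_m -> V}} := [set u : {ffun 'I_m -> V} | (u \notin A1) &&
  (meval (fun j => point (u (emb j))) G == 0)].
have sub : [set u : {ffun 'I_m -> V} | meval (fun j => point (u (emb j))) G == 0] \subset A1 :|: A2.
  by apply/fintype.subsetP => u; rewrite !inE => ->; rewrite andbT orbN.
apply: le_trans (product_weightS p_ge0 sub) _.
apply: le_trans (product_weightU _ _ p_ge0) _.
rewrite -natr1 mulrDl mul1r lerD ?IHk // (@product_weight_resample _ _ _ _ _ i) // => u.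
pose f : {poly R} := map_poly (meval (fun j => point (u (emb' j)))) (muni G).
have update_emb' x j : update u i x (emb' j) = u (emb' j) by rewrite update_neq.
(* Resampling coordinate [i] does not affect membership in [A1], so here the sum is empty; [0 <= K]
   comes from [le_K] at the empty set. *)
have [u_A1|u_A1] := boolP (u \in A1).
  rewrite big1 ?(le_trans _ (le_K i finset.set0 _)) ?big_set0 ?cards0 // => x.
  rewrite !inE => /andP[/negP[]]; rewrite inE in u_A1.
  by rewrite (@eq_meval _ _ _ (fun j => point (u (emb' j)))) ?u_A1 // => j; rewrite update_emb'.
have f_neq0 : f != 0.
  rewrite -lead_coef_eq0 lead_coef_map_eq //; last by rewrite inE in u_A1.
  by rewrite inE in u_A1.
apply: le_trans (le_K i [set x | root f (point x)] _); last first.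
  rewrite -ltnS (leq_trans (card_root_preim_le point_inj f_neq0)) //.
  by rewrite (leq_trans (size_poly _ _)) // size_muni_le.
rewrite [leRHS](eq_bigl (fun x => root f (point x))) => [|x]; last by rewrite inE.
rewrite [leLHS]big_mkcond [leRHS]big_mkcond /=; apply: ler_sum => x _.
case: ifP => [|_]; last by case: ifP.
rewrite !inE meval_muni => /andP[_]; rewrite ffunE eqxx -rootE.
rewrite (_ : map_poly _ _ = f) => [->//|].
apply/polyP => e; rewrite !coef_map_id0 ?meval0 //; apply: eq_meval => j.
by rewrite update_emb'.
Qed.

End ProductWeight.

(** * The weight of reducible specializations *)

Section ReducibleWeight.

Lemma degree_leM (R : nzRingType) (n : nat) (p q : mpoly n R) (D E : nat) :
  degree_le D p -> degree_le E q -> degree_le (D + E) (p * q).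
Proof.
move=> le_p le_q; rewrite /degree_le msizeE; apply/bigmax_leqP_seq => m m_pq _.
have /allpairsP[[m1 m2] /= [m1_p m2_q ->]] := msuppM_le m_pq.
rewrite mdegD ltnS leq_add // -ltnS.
  exact: leq_trans (msize_mdeg_lt m1_p) le_p.
exact: leq_trans (msize_mdeg_lt m2_q) le_q.
Qed.

Lemma degree_leX (R : nzRingType) (n : nat) (p : mpoly n R) (D e : nat) :
  degree_le D p -> degree_le (D * e) (p ^+ e).
Proof.
move=> le_p; elim: e => [|e IHe]; first by rewrite muln0 expr0 /degree_le msize1.
by rewrite exprS mulnS; apply: degree_leM.
Qed.

Lemma degree_le_comp (R : nzRingType) (n k : nat) (lq : n.-tuple (mpoly k R))
    (p : mpoly n R) (L : nat) :
  (forall i, degree_le 1 (tnth lq i)) -> degree_le L p -> degree_le L (comp_mpoly lq p).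
Proof.
move=> le_lq le_p; rewrite /degree_le comp_mpolyEX.
apply: leq_trans (mmeasure_sum _ _ _ _) _; apply/bigmax_leqP_seq => m m_p _.
apply: leq_trans (mmeasureZ_le _ _ _) _; rewrite comp_mpolyX.
apply: leq_trans (leq_trans (msize_mdeg_lt m_p) le_p); rewrite mdegE -/(degree_le _ _).
elim/big_ind2: _ => [|q D r E|i _]; first by rewrite /degree_le msize1.
  exact: degree_leM.
by rewrite -[X in degree_le X _]mul1n; apply: degree_leX.
Qed.

Lemma degree_le_fix_first (R : nzRingType) (m : nat) (c : R) (F : mpoly m.+1 R) (L : nat) :
  degree_le L F -> degree_le L (fix_first c F).
Proof.
move=> le_F; apply: degree_le_comp le_F => i; rewrite tnth_map tnth_ord_tuple.
rewrite /cons_arg; case: (unlift ord0 i) => [j|]; rewrite /degree_le.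
  by rewrite msizeX mdeg1.
by rewrite msizeC; case: eqP.
Qed.

Lemma meval_fix_first (R : comNzRingType) (m : nat) (c : R) (F : mpoly m.+1 R) (v : 'I_m -> R) :
  meval v (fix_first c F) = meval (cons_arg c v) F.
Proof.
rewrite comp_mpoly_meval; apply: eq_meval => i.
rewrite tnth_map tnth_ord_tuple /cons_arg.
by case: (unlift ord0 i) => [j|]; rewrite ?mevalXU ?mevalC.
Qed.

(** The arguments of [F1] leave out the last variable, so resampling it keeps all coefficients other
    than [a_k]. *)
Lemma cons_arg_update_max (V : finType) (T : Type) (m : nat) (point : V -> T) (c : T)
    (u : {ffun 'I_m.+1 -> V}) (x : V) (i : 'I_m.+1) :
  cons_arg c (fun j => point (update u ord_max x j)) (widen_ord (leqnSn m.+1) i) =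
  cons_arg c (fun j => point (u j)) (widen_ord (leqnSn m.+1) i).
Proof.
rewrite /cons_arg; case: unliftP => // j /(congr1 val) /= iE.
rewrite update_neq //; apply/eqP => j_max; rewrite j_max /= in iE.
by have := ltn_ord i; rewrite iE ltnn.
Qed.

Lemma eq_monic_of (d : nat) (a b : nat -> int) :
  (forall j, (j < d)%N -> a j = b j) -> monic_of d a = monic_of d b.
Proof.
move=> eq_ab; congr (_ + _); apply/polyP => j; rewrite !coef_poly.
by case: ifP => // /eq_ab.
Qed.

(** [F1] and [F2] have real values, so integrality of the coefficients at [v] is part of the
    condition. *)
Definition reducible_at (R : realType) (d m k : nat) (c : int) (F2 : mpoly m.+2 R)
    (F1 : nat -> mpoly m.+1 R) (v : 'I_m.+1 -> R) : Prop :=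
  exists a : nat -> int, [/\ a 0%N = c,
    (a k)%:~R = meval (cons_arg c%:~R v) F2,
    forall j, (0 < j < d)%N -> j != k -> (a j)%:~R =
      meval (fun i => cons_arg c%:~R v (widen_ord (leqnSn m.+1) i)) (F1 j) &
    ~ irreducibleZ (monic_of d a)].

(** Either the leading coefficient of [F2] in the last variable vanishes, which has weight at most
    [m * K] by Schwartz-Zippel in the [m] other variables, or for each of the [2 * tau c] signed
    divisors [b] the last coordinate is confined to at most [2 ^ d * L] values. *)
Lemma reducible_weight_le (R : realType) (d m k L : nat) (c : int) (F2 : mpoly m.+2 R)
    (F1 : nat -> mpoly m.+1 R) (V : finType) (point : V -> R) (p : 'I_m.+1 -> V -> R) (K : R) :
  (0 < k < d)%N -> coprime k d -> c != 0 ->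
  degree_le L F2 -> (0 < degree_in ord_max (fix_first c%:~R F2))%N ->
  injective point -> (forall i x, 0 <= p i x) -> (forall i, \sum_x p i x = 1) ->
  (forall i (X : {set V}), (#|X| <= 2 ^ d * L)%N -> \sum_(x in X) p i x <= K) ->
  product_weight p [set u : {ffun 'I_m.+1 -> V} |
      `[< reducible_at d k c F2 F1 (fun i => point (u i)) >]]
    <= (m + 2 * tau c)%:R * K.
Proof.
move=> k_bounds co_kd c_neq0 le_F2 F2_deg point_inj p_ge0 p_sum le_K.
have k_neq0 : k != 0%N by rewrite -lt0n; case/andP: k_bounds.
pose G : mpoly m.+1 R := fix_first c%:~R F2.
have le_G : degree_le L G by apply: degree_le_fix_first.
pose g := lead_coef (muni G).
have size_G : (1 < size (muni G))%N by apply: size_muni_gt1.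
have g_neq0 : g != 0 by rewrite lead_coef_eq0 -size_poly_eq0 -lt0n ltnW.
have le_g : degree_le L g by apply: degree_le_coef_muni.
pose emb := @widen_ord m m.+1 (leqnSn m).
have emb_inj : injective emb by move=> j1 j2 /(congr1 val) /= /val_inj.
have le_L : (L <= 2 ^ d * L)%N by rewrite leq_pmull // expn_gt0.
pose A1 : {set {ffun 'I_m.+1 -> V}} :=
  [set u : {ffun 'I_m.+1 -> V} | meval (fun j => point (u (emb j))) g == 0].
have A1_le : product_weight p A1 <= m%:R * K.
  apply: (@schwartz_zippel_weight _ _ _ _ _ L) => // i X le_X.
  by apply: le_K; apply: leq_trans le_L.
have /choice[S SP] : forall a : nat -> int, exists S : int -> seq int,
    a 0%N != 0 -> (forall b, size (S b) <= 2 ^ d)%N /\ forall T : int,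
    ~ irreducibleZ (monic_of d (fun j => if j == k then T else a j)) ->
    exists2 b, b \in signed_divisors (a 0%N) & T \in S b.
  move=> a; have [a0|a0_neq0] := eqVneq (a 0%N) 0; first by exists (fun=> [::]).
  by have [S ? ?] := reducible_parameters_cover k_bounds co_kd a0_neq0; exists S.
pose a_ (u : {ffun 'I_m.+1 -> V}) j : int := if j == 0%N then c else
  if (j < d)%N && (j != k) then Num.floor (meval (fun i => cons_arg c%:~R
    (fun i => point (u i)) (widen_ord (leqnSn m.+1) i)) (F1 j)) else 0.
have a_0 u : a_ u 0%N = c by [].
have a_update u x : a_ (update u ord_max x) = a_ u.
  apply/funext => j; rewrite /a_; case: eqP => // _; case: ifP => // _.
  by congr Num.floor; apply: eq_meval => i; apply: cons_arg_update_max.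
pose A b : {set {ffun 'I_m.+1 -> V}} := [set u : {ffun 'I_m.+1 -> V} | (u \notin A1) &&
  has (fun T => meval (cons_arg c%:~R (fun i => point (u i))) F2 == T%:~R) (S (a_ u) b)].
have A_le b : product_weight p (A b) <= K.
  apply: (product_weight_resample (i := ord_max)) => // u.
  pose f : {poly R} := map_poly (meval (fun j => point (u (emb j)))) (muni G).
  have eq_emb x : (fun j => point (update u ord_max x (emb j))) =1 (fun j => point (u (emb j))).
    by move=> j; rewrite update_neq // -val_eqE /= ltn_eqF.
  have [u_A1|u_A1] := boolP (u \in A1).
    rewrite big1 ?(le_trans _ (le_K ord0 finset.set0 _)) ?big_set0 ?cards0 // => x.
    rewrite !inE => /andP[/negP[]]; rewrite inE in u_A1.
    by rewrite (eq_meval _ (eq_emb x)).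
  have f_lead : lead_coef f = meval (fun j => point (u (emb j))) g.
    by rewrite lead_coef_map_eq //; rewrite inE in u_A1.
  have size_f : size f = size (muni G).
    by rewrite size_poly_eq //; rewrite inE in u_A1.
  have a_c : a_ u 0%N != 0 by [].
  have [size_S _] := SP (a_ u) a_c.
  pose X := (\bigcup_(T <- S (a_ u) b) [set x | root (f - (T%:~R)%:P) (point x)])%SET.
  apply: (@le_trans _ _ (\sum_(x in X) p ord_max x)); last first.
    apply: le_K; apply: leq_trans (_ : size (S (a_ u) b) * L <= _)%N; last first.
      by rewrite leq_mul2r size_S orbT.
    rewrite /X; elim: (S (a_ u) b) => [|T s IHs]; first by rewrite big_nil cards0.
    rewrite big_cons mulSn (leq_trans (leq_card_setU _ _)) // leq_add //.
    (* The degree of [f] is positive, so subtracting a constant changes neither its size nor the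
       fact that it is nonzero. *)
    have size_fT : size (f - (T%:~R)%:P) = size f.
      by rewrite size_polyDl // size_polyN (leq_ltn_trans (size_polyC_leq1 _)) // size_f.
    rewrite -ltnS (leq_trans (card_root_preim_le point_inj _)) //.
      by rewrite -size_poly_eq0 size_fT size_f -lt0n ltnW.
    by rewrite size_fT size_f size_muni_le.
  rewrite [leLHS]big_mkcond [leRHS]big_mkcond /=; apply: ler_sum => x _.
  case: ifP => [|_]; last by case: ifP.
  rewrite inE a_update => /andP[_ /hasP[T T_S /eqP evalT]].
  suff -> : x \in X by [].
  rewrite /X (big_rem T) //= !inE; apply/orP; left.
  rewrite rootE hornerD hornerN hornerC subr_eq0 -evalT -meval_fix_first -/G meval_muni.
  rewrite ffunE eqxx; apply/eqP; congr (_.[_]).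
  by apply/polyP => e; rewrite !coef_map_id0 ?meval0 //; apply: eq_meval => j; rewrite eq_emb.
have sub : [set u : {ffun 'I_m.+1 -> V} |
    `[< reducible_at d k c F2 F1 (fun i => point (u i)) >]]%SET \subset
    A1 :|: \bigcup_(b <- signed_divisors c) A b.
  apply/fintype.subsetP => u; rewrite inE => /asboolP[a [a0 ak aj red]]; rewrite finset.in_setU inE.
  have [//|u_A1] := boolP (_ == 0); rewrite /=.
  have a_j j : (j < d)%N -> (if j == k then a k else a_ u j) = a j.
    move=> lt_j; case: eqVneq => [->//|j_k]; rewrite /a_.
    have [->|j_neq0] := eqVneq j 0%N; first by rewrite a0.
    by rewrite lt_j j_k -aj ?intrKfloor // lt0n j_neq0.
  have a_c : a_ u 0%N != 0 by [].
  have [_ /(_ (a k))] := SP (a_ u) a_c; rewrite (eq_monic_of a_j) => /(_ red)[b b_c ak_S].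
  rewrite (big_rem b) //= inE; apply/orP; left; rewrite inE inE u_A1 /=.
  by apply/hasP; exists (a k) => //; rewrite -ak.
apply: le_trans (product_weightS p_ge0 sub) _.
apply: le_trans (product_weightU _ _ p_ge0) _.
rewrite natrD mulrDl lerD //.
by apply: le_trans (product_weight_bigcup _ p_ge0 A_le) _; rewrite size_signed_divisors.
Qed.

End ReducibleWeight.

(** * Uniform values of a polynomial *)

Section Values.

Lemma size_values (P : {poly int}) (H : nat) : size (values P H) = (2 * H).+1.
Proof. by rewrite size_map size_iota. Qed.

Lemma count_values_le (P : {poly int}) (H : nat) (v : int) : P != v%:P ->
  (count_mem v (values P H) <= (size P).-1)%N.
Proof.
move=> P_neq; have Pv_neq0 : P - v%:P != 0 by rewrite subr_eq0.
pose s := [seq n%:Z - H%:Z | n <- iota 0 (2 * H).+1 & P.[n%:Z - H%:Z] == v].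
have -> : count_mem v (values P H) = size s.
  by rewrite size_map size_filter count_map; apply: eq_count.
have size_Pv : (size (P - v%:P)%R <= (size P).-1.+1)%N.
  rewrite (leq_trans (size_polyD _ _)) // size_polyN geq_max leqSpred.
  by rewrite (leq_trans (size_polyC_leq1 _)).
rewrite -ltnS; apply: leq_trans size_Pv; apply: max_poly_roots => //.
  apply/allP => x /mapP[n]; rewrite mem_filter => /andP[/eqP Pn _] ->.
  by rewrite rootE !hornerE Pn subrr.
rewrite map_inj_uniq ?filter_uniq ?iota_uniq // => x y /(congr1 (fun z => z + H%:Z)).
by rewrite !subrK => -[].
Qed.

Lemma sum_undup_count (V : nmodType) (I : eqType) (s : seq I) (F : I -> V) :
  \sum_(i <- undup s) F i *+ count_mem i s = \sum_(i <- s) F i.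
Proof. by rewrite -[RHS]big_undup_iterop_count. Qed.

Lemma sum_count_undup (I : eqType) (s : seq I) :
  (\sum_(i <- undup s) count_mem i s)%N = size s.
Proof.
rewrite -sum1_size -[RHS](big_undup_iterop_count addn); apply: eq_bigr => i _.
by rewrite Monoid.iteropE iter_addn_0 mul1n.
Qed.

(** A nonconstant [P] takes each value at most deg P times, so its distinct values are at least
    [2 * H + 1] divided by deg P in number. This compares uniformity on distinct values with
    uniformity counted with multiplicity; [maxn 1] accounts for constant [P]. *)
Lemma size_values_le (P : {poly int}) (H : nat) (v : int) : v \in values P H ->
  ((2 * H).+1 <= maxn 1 (size P).-1 * count_mem v (values P H) * size (undup (values P H)))%N.
Proof.
move=> v_P; have count_gt0 : (0 < count_mem v (values P H))%N by rewrite -has_count has_pred1.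
have undup_gt0 : (0 < size (undup (values P H)))%N.
  by rewrite -has_predT; apply/hasP; exists v; rewrite ?mem_undup.
have [P_const|P_nconst] := leqP (size P) 1.
  have -> : count_mem v (values P H) = (2 * H).+1.
    rewrite -(size_values P H); apply/eqP; rewrite -all_count; apply/allP => x /mapP[n _ ->].
    by case/mapP: v_P => n' _ ->; rewrite (size1_polyC P_const) !hornerC /=.
  by rewrite mulnAC leq_pmull // muln_gt0 undup_gt0 leq_max.
rewrite -(size_values P H) -(sum_count_undup (values P H)).
apply: (@leq_trans (\sum_(x <- undup (values P H)) (size P).-1)%N).
  apply: leq_sum => x _; apply: count_values_le.
  by apply: contraTneq P_nconst => ->; rewrite -leqNgt size_polyC_leq1.
rewrite big_const_seq count_predT iter_addn_0 leq_mul2r; apply/orP; right.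
by apply: (@leq_trans (maxn 1 (size P).-1)); rewrite ?leq_maxr ?leq_pmulr.
Qed.

End Values.

(** * Probability of reducibility *)

Section Probability.
Local Open Scope classical_set_scope.
Local Open Scope ring_scope.
Local Open Scope ereal_scope.

(** * Measurability, almost sure inclusion and joint laws *)

Lemma measure_bigcup_seq_le (R : realType) (disp : measure_display) (Omega : measurableType disp)
    (mu : {measure set Omega -> \bar R}) (I : eqType) (s : seq I) (F : I -> set Omega) :
  (forall i, measurable (F i)) ->
  mu (\bigcup_(i in [set` s]) F i) <= \sum_(i <- s) mu (F i).
Proof.
move=> mF; elim: s => [|i s IHs].
  by rewrite big_nil (_ : [set` [::]] = set0) ?bigcup_set0 ?measure0 // -subset0.
have -> : [set` i :: s] = [set i] `|` [set` s].
  apply/seteqP; split => j /=; rewrite inE; first by case/predU1P; [left|right].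
  by case=> [->|->]; rewrite ?eqxx ?orbT.
rewrite bigcup_setU bigcup_set1 big_cons (le_trans (measureU2 _ _ _)) //.
  by apply: fin_bigcup_measurable => //; apply: finite_seq.
by rewrite leeD2l.
Qed.

Lemma ae_le_measure (R : realType) (disp : measure_display) (Omega : measurableType disp)
    (mu : {measure set Omega -> \bar R}) (A B : set Omega) :
  measurable A -> measurable B -> {ae mu, forall w, A w -> B w} -> mu A <= mu B.
Proof.
move=> mA mB [N [mN N0 sub]]; rewrite -(measureU0 mB mN N0); apply: le_measure.
- by rewrite inE.
- by rewrite inE; apply: measurableU.
move=> w Aw; have [Nw|Nw] := pselect (N w); first by right.
by left; apply: contrapT => Bw; apply: Nw; apply: sub => /(_ Aw).
Qed.

Lemma measurable_tuple_set1 (R : realType) (m : nat) (v : m.-tuple R) :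
  measurable [set v : m.-tuple (measurableTypeR R)].
Proof.
rewrite (_ : [set v] = \bigcap_(i in [set: 'I_m]) ((@tnth m R)^~ i @^-1` [set tnth v i])).
  apply: fin_bigcap_measurable => // i _.
  rewrite -[X in measurable X]setTI; apply: measurable_tnth => //.
apply/seteqP; split => [_ -> //|w /= vw].
by apply/eq_from_tnth => i; apply: vw.
Qed.

(** The event is a finite union of events fixing all the [t i], and independence over the full index
    set factors the probability of each. *)
Lemma joint_law_le (R : realType) (m : nat) (disp : measure_display)
    (Omega : measurableType disp) (Pr : probability Omega R) (t : 'I_m -> {RV Pr >-> R})
    (V : finType) (point : V -> R) (A : {set {ffun 'I_m -> V}}) :
  mutually_independent Pr (fun i => t i : Omega -> R) ->
  Pr [set w | exists2 u, u \in A & forall i, t i w = point (u i)] <=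
    (product_weight (fun i x => fine (Pr (t i @^-1` [set point x]))) A)%:E.
Proof.
move=> indep.
have mt i (x : V) : measurable (t i @^-1` [set point x]).
  by apply: measurable_funPTI.
have -> : [set w | exists2 u, u \in A & forall i, t i w = point (u i)] =
    \bigcup_(u in [set` enum A]) \bigcap_(i in [set` [set: 'I_m]%SET])
      (t i @^-1` [set point (u i)]).
  apply/seteqP; split => w /=.
    move=> [u u_A tu]; exists u; first by rewrite /= fintype.mem_enum.
    by move=> i _; apply: tu.
  by move=> [u /=]; rewrite fintype.mem_enum => u_A tu; exists u => // i; apply: tu; rewrite /= inE.
apply: le_trans (measure_bigcup_seq_le _ _ _) _.
  by move=> u; apply: fin_bigcap_measurable.
rewrite /product_weight -sumEFin big_enum /=; apply: lee_sum => u _.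
rewrite (indep [set: 'I_m]%SET (fun i => [set point (u i)])) => [|i _]; last exact: measurable_set1.
rewrite -prodEFin; rewrite (eq_bigl xpredT) => [|i]; last by rewrite inE.
by rewrite (eq_bigr (fun i => (fine (Pr (t i @^-1` [set point (u i)])))%:E)) // => i _;
  rewrite fineK // fin_num_measure.
Qed.

Lemma sum_prob_points (R : realType) (disp : measure_display)
    (Omega : measurableType disp) (Pr : probability Omega R) (X : {RV Pr >-> R})
    (s : seq R) : uniq s ->
  (\sum_(x <- s) fine (Pr (X @^-1` [set x])))%:E = distribution Pr X [set` s].
Proof.
move=> uniq_s; rewrite -sumEFin.
have mX x : measurable (X @^-1` [set x]) by apply: measurable_funPTI.
have -> : [set` s] = \bigcup_(x in [set` s]) [set x].
  by apply/seteqP; split => [x xs|x [y ys ->]]; first by exists x.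
rewrite /distribution /pushforward preimage_bigcup measure_fin_bigcup //.
- rewrite -fsbig_seq //; apply: eq_bigr => x _; by rewrite fineK // fin_num_measure.
- exact: finite_seq.
- by apply/trivIsetP => x y _ _ /eqP xy; apply/seteqP; split => // w [/= -> /xy].
Qed.

Lemma measurable_finite_set (R : realType) (A : set R) :
  finite_set A -> measurable (A : set (measurableTypeR R)).
Proof.
move=> finA; rewrite (_ : A = \bigcup_(x in A) [set x]).
  by apply: fin_bigcup_measurable => // x _; apply: measurable_set1.
by apply/seteqP; split => [x Ax|x [y Ay ->]]; first by exists x.
Qed.

(** The event depends on [d] integer coefficients only, hence is a countable union over their
    possible values. *)
Lemma measurable_irreducible (R : realType) (disp : measure_display)
    (Omega : measurableType disp) (Pr : probability Omega R) (a : nat -> {RV Pr >-> int})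
    (d : nat) : measurable [set w | irreducibleZ (monic_of d (fun j => a j w))].
Proof.
have -> : [set w | irreducibleZ (monic_of d (fun j => a j w))] =
    \bigcup_(v in [set: d.-tuple int]) [set w | (forall j : 'I_d, a j w = tnth v j) /\
       irreducibleZ (monic_of d (fun j => a j w))].
  apply/seteqP; split => w /= [] => [irr1 irr2|v _ [_ ?]//].
  by exists [tuple a j w | j < d] => //; split => // j; rewrite tnth_mktuple.
apply: countable_bigcupT_measurable => [|v]; first exact: countableP.
pose b j := nth 0%R v j.
have [irr|red] := pselect (irreducibleZ (monic_of d b)).
  have -> : [set w | (forall j : 'I_d, a j w = tnth v j) /\
       irreducibleZ (monic_of d (fun j => a j w))] =
      \bigcap_(j in [set: 'I_d]) (a j @^-1` [set tnth v j]).
    apply/seteqP; split => [w [aw _] j _|w /= aw]; first exact: aw.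
    have {}aw (j : 'I_d) : a j w = tnth v j by apply: aw.
    split => //; rewrite (@eq_monic_of _ _ b) // => j lt_j.
    by rewrite (aw (Ordinal lt_j)) (tnth_nth 0%R).
  by apply: fin_bigcap_measurable => // j _; apply: measurable_funPTI.
rewrite (_ : [set w | _] = set0) // -subset0 => w [aw irr]; apply: red.
rewrite (@eq_monic_of _ _ (fun j => a j w)) // => j lt_j.
by rewrite (aw (Ordinal lt_j)) (tnth_nth 0%R).
Qed.

Lemma measurable_int_preimage (R : realType) (disp : measure_display)
    (Omega : measurableType disp) (Pr : probability Omega R) (X : {RV Pr >-> int})
    (A : set int) : measurable (X @^-1` A).
Proof. exact: measurable_funPTI. Qed.

(** On the event that the constant coefficient is [c], reducibility almost surely confines the [t i]
    to a finite set of points. Independence factors out the probability of that event, and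
    [reducible_weight_le] bounds the rest. *)
Lemma reducible_prob_le (R : realType) (d m L H : nat) (C : R) (disp : measure_display)
    (Omega : measurableType disp) (Pr : probability Omega R)
    (t : 'I_m -> {RV Pr >-> R}) (a : nat -> {RV Pr >-> int}) (c : int) :
  random_poly d L H C t a -> (c != 0)%R ->
  Pr [set w | a 0%N w = c /\ ~ irreducibleZ (monic_of d (fun j => a j w))] <=
  (2 * C * d%:R * m%:R * 2 ^+ d * L%:R / H%:R * (tau c)%:R)%R%:E * Pr [set w | a 0%N w = c].
Proof.
case=> d_ge2 m_gt0 L_gt0 H_gt0 C_gt0 indep indep0 unif coef c_neq0.
case: m t m_gt0 indep indep0 unif coef => // m t _ indep indep0 unif.
case=> k [F2 [F1 [[k_bounds co_kd] [le_F2 _] F2_deg ak aj]]].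
have /choice[Hs HsP] := unif.
(* The weights need one finite type common to all coordinates, hence the union of the supports. *)
pose U : {fset R} := [fset x in flatten [seq enum_fset (Hs i) | i <- enum 'I_m.+1]]%fset.
have HsU i x : x \in Hs i -> x \in U 
  by move=> x_Hi; rewrite inE; apply/flatten_mapP; exists i; rewrite ?fintype.mem_enum.
pose point (x : U) : R := val x.
have point_inj : injective point by apply: val_inj.
pose p i x := fine (Pr (t i @^-1` [set point x])).
have p_ge0 i x : (0 <= p i x)%R by apply: fine_ge0.
have sumE i (X : {set U}) : (\sum_(x in X) p i x)%R%:E =
    distribution Pr (t i) [set` [seq point x | x <- enum X]].
  rewrite -sum_prob_points; first by rewrite big_map big_enum.
  by rewrite map_inj_uniq ?enum_uniq.
have p_sum i : (\sum_x p i x = 1)%R.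
  apply: EFin_inj; rewrite (eq_bigl (fun x => x \in [set: U]%SET)) => [|x]; last by rewrite inE.
  rewrite sumE; apply/eqP; rewrite eq_le probability_le1 /=; last first.
    by apply: measurable_finite_set; apply: finite_seq.
  have [_ [<- _]] := HsP i; apply: le_measure; rewrite ?inE.
  - by apply: measurable_finite_set; apply: finite_fset.
  - by apply: measurable_finite_set; apply: finite_seq.
  move=> w /= tw; apply/mapP; exists [` HsU i _ tw]%fset => //.
  by rewrite fintype.mem_enum inE.
(* [K] bounds the mass of [N] points under a [(C, N)]-uniform law on at least [H] points. *)
pose N := (2 ^ d * L)%N; pose K := (C * N%:R / H%:R)%R.
have K_le i (X : {set U}) : (#|X| <= N)%N -> (\sum_(x in X) p i x <= K)%R.
  move=> le_N; have [le_H [_ Hi_unif]] := HsP i.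
  rewrite -lee_fin sumE; pose s := [seq point x | x <- enum X].
  have size_s : #|` [fset x in s]%fset| = #|X|.
    by rewrite card_fseq undup_id ?map_inj_uniq ?enum_uniq // size_map -cardE.
  have -> : [set` s] = [set` [fset x in s]%fset].
    by apply/seteqP; split => x /=; rewrite inE.
  apply: le_trans (Hi_unif _ _) _; first by rewrite size_s.
  rewrite size_s lee_fin; apply: ler_pM.
  - by rewrite mulr_ge0 // ltW.
  - by rewrite invr_ge0.
  - by rewrite ler_wpM2l ?ler_nat // ltW.
  - by rewrite lef_pV2 ?ler_nat // posrE ltr0n // (leq_trans H_gt0).
pose A := [set u : {ffun 'I_m.+1 -> U} |
  `[< reducible_at d k c F2 F1 (fun i => point (u i)) >]]%SET.
have A_le : (product_weight p A <= (m + 2 * tau c)%:R * K)%R.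
  by apply: reducible_weight_le K_le => //; apply: F2_deg.
pose tup (u : {ffun 'I_m.+1 -> U}) := [tuple point (u i) | i < m.+1].
(* The exceptional points are gathered as a measurable set of tuples, the form in which independence
   from the constant coefficient is given. *)
pose S : set (m.+1.-tuple R) := \bigcup_(u in [set` enum A]) [set tup u].
have mS : measurable (S : set (m.+1.-tuple (measurableTypeR R))).
  apply: fin_bigcup_measurable => [|u _]; first exact: finite_seq.
  exact: measurable_tuple_set1.
pose T w := [tuple t i w | i < m.+1].
have T_S : T @^-1` S = [set w | exists2 u, u \in A & forall i, t i w = point (u i)].
  apply/seteqP; split => w /=.
    move=> [u /=]; rewrite fintype.mem_enum => u_A Tu; exists u => // i.
    by have := congr1 (fun v => tnth v i) Tu; rewrite !tnth_mktuple.
  move=> [u u_A tu]; exists u; first by rewrite /= fintype.mem_enum.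
  by apply/eq_from_tnth => i; rewrite !tnth_mktuple.
have Pr_S : Pr (T @^-1` S) <= ((m + 2 * tau c)%:R * K)%R%:E.
  by rewrite T_S (le_trans (joint_law_le _ _ indep)) // lee_fin.
have mT : measurable (T @^-1` S).
  rewrite -[X in measurable X]setTI.
  have /measurable_fun_tnthP mT : forall i, measurable_fun setT
      ((@tnth _ R)^~ i \o (T : Omega -> m.+1.-tuple (measurableTypeR R))).
    move=> i; rewrite (_ : _ \o _ = t i); first exact: measurable_funP.
    by apply/funext => w /=; rewrite tnth_mktuple.
  exact: mT.
have ma0 : measurable [set w | a 0%N w = c] by exact: (measurable_int_preimage (a 0%N) [set c]).
apply: (@le_trans _ _ (Pr ([set w | a 0%N w = c] `&` T @^-1` S))).
  apply: ae_le_measure.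
  - apply: measurableI => //; apply: measurableC; exact: measurable_irreducible.
  - exact: measurableI.
  (* Almost surely every [t i] lies in its finite set and the coefficient relations hold; off this
     null event a reducible polynomial yields a point of [A]. *)
  have t_ae i : {ae Pr, forall w, t i w \in Hs i}.
    exists (~` (t i @^-1` [set` Hs i])); split.
    - apply: measurableC; apply: measurable_funPTI.
      by apply: measurable_finite_set; apply: finite_fset.
    - rewrite probability_setC; last first.
        by apply: measurable_funPTI; apply: measurable_finite_set; apply: finite_fset.
      by have [_ [Hi1 _]] := HsP i; rewrite [X in 1 - X]Hi1 subee.
    - by [].
  have aj_ae (j : 'I_d) : {ae Pr, forall w, (0 < j < d)%N -> j != k :> nat ->
      (a j w)%:~R = meval (fun i : 'I_m.+1 => cons_arg (a 0%N w)%:~R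
        (fun i => t i w) (widen_ord (leqnSn m.+1) i)) (F1 j)}.
    have [j_bounds|j_bounds] := boolP (0 < j < d)%N; last first.
      by apply: aeW.
    have [j_k|j_k] := eqVneq (j : nat) k; first by apply: aeW.
    by have := aj j j_bounds j_k; apply: filterS => w jE _ _.
  have {}t_ae : {ae Pr, forall w, forall i, t i w \in Hs i} by apply: filter_forall.
  have {}aj_ae : {ae Pr, forall w, forall j : 'I_d, (0 < j < d)%N -> j != k :> nat ->
      (a j w)%:~R = meval (fun i : 'I_m.+1 => cons_arg (a 0%N w)%:~R
        (fun i => t i w) (widen_ord (leqnSn m.+1) i)) (F1 j)} by apply: filter_forall.
  move: ak t_ae aj_ae; apply: filterS3 => w ak tw aj_w [a0 red].
  split => //; rewrite T_S /=.
  exists [ffun i => [` HsU i _ (tw i)]%fset]; last by move=> i; rewrite ffunE.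
  rewrite inE; apply/asboolP; exists (fun j => a j w); split => //.
    by rewrite ak a0; apply: eq_meval => i; congr cons_arg; apply/funext => j; rewrite ffunE.
  move=> j j_bounds j_k; have /andP[_ lt_j] := j_bounds.
  rewrite (aj_w (Ordinal lt_j)) // a0; apply: eq_meval => i.
  by congr cons_arg; apply/funext => l; rewrite ffunE.
have -> : Pr ([set w | a 0%N w = c] `&` T @^-1` S) = Pr [set w | a 0%N w = c] * Pr (T @^-1` S).
  by apply: (indep0 [set c] S).
rewrite muleC; apply: lee_wpmul2r; first exact: measure_ge0.
apply: le_trans Pr_S _; rewrite lee_fin /K /N natrM natrX.
have tau_gt0 : (0 < tau c)%N.
  by rewrite /tau -has_predT; apply/hasP; exists 1%N => //; rewrite -dvdn_divisors ?absz_gt0.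
have -> : (2 * C * d%:R * m.+1%:R * 2 ^+ d * L%:R / H%:R * (tau c)%:R =
  (2 * d * m.+1 * tau c)%N%:R * (C * (2 ^+ d * L%:R) / H%:R) :> R)%R.
  by rewrite !natrM; ring.
apply: ler_wpM2r.
  by rewrite divr_ge0 // mulr_ge0 ?mulr_ge0 ?exprn_ge0 // ltW.
rewrite ler_nat; move: (tau c) tau_gt0 d_ge2; clear => n n_gt0 d_ge2.
(* There are [m.+1] variables here. With at least one divisor and [2 <= d], the count [m + 2 * n] is
   at most [2 * d * m.+1 * n], the constant of the bound. *)
have : (m + 2 * n <= 2 * 2 * m.+1 * n)%N by nia.
by move/leq_trans; apply; rewrite leq_mul // leq_mul // leq_mul.
Qed.

(** Sum the bounds for fixed [c] over all nonzero [c]. The computation stays in the extended reals,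
    where the expectation may be infinite. *)
Lemma reducible_expectation_le (R : realType) (d m L H : nat) (C : R) (disp : measure_display)
    (Omega : measurableType disp) (Pr : probability Omega R)
    (t : 'I_m -> {RV Pr >-> R}) (a : nat -> {RV Pr >-> int}) :
  random_poly d L H C t a ->
  Pr [set w | a 0%N w <> 0%R /\ ~ irreducibleZ (monic_of d (fun j => a j w))] <=
  (2 * C * d%:R * m%:R * 2 ^+ d * L%:R / H%:R)%R%:E *
    'E_Pr[(fun w => (tau (a 0%N w))%:R * (a 0%N w != 0)%:R)%R].
Proof.
move=> rp; have C_gt0 := rp_C rp; set K := (_ / _)%R.
have K_ge0 : (0 <= K)%R.
  by rewrite /K divr_ge0 ?mulr_ge0 ?exprn_ge0 // ltW.
pose X (c : int) : R := ((tau c)%:R * (c != 0)%:R)%R.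
have X_ge0 c : (0 <= X c)%R by rewrite mulr_ge0.
(* The integers are numbered by [choice.pickle] to obtain a partition indexed by the natural
   numbers; numbers that code no integer give empty pieces. *)
pose D n := [set w | choice.pickle (a 0%N w) = n].
have mD n : measurable (D n).
  exact: (measurable_int_preimage (a 0%N) [set c | choice.pickle c = n]).
have D_full : \bigcup_n D n = setT.
  by apply/seteqP; split => // w _; exists (choice.pickle (a 0%N w)).
have D_triv : trivIset setT D.
  apply/trivIsetP => i j _ _ /eqP ij; apply/seteqP; split => // w [Di Dj].
  by case: ij; rewrite -Di -Dj.
pose B := [set w | a 0%N w <> 0%R /\ ~ irreducibleZ (monic_of d (fun j => a j w))].
have mB : measurable B.
  apply: measurableI; last by apply: measurableC; apply: measurable_irreducible.
  exact: (measurable_int_preimage (a 0%N) [set c | c <> 0%R]).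
rewrite -/B unlock -D_full ge0_integral_bigcup //; last first.
  move=> _ Y mY; rewrite D_full setTI.
  exact: (measurable_int_preimage (a 0%N) [set c | Y (X c)%:E]).
rewrite -nneseriesZl => [|n _]; last by apply: integral_ge0 => w _; rewrite lee_fin.
apply: (@le_trans _ _ (\big[+%E/0]_(0 <= n <oo) Pr (B `&` D n))).
  apply: measure_sigma_subadditive => //; first by move=> n; apply: measurableI.
  by rewrite -setI_bigcupr D_full setIT.
apply: lee_nneseries => // n _.
have [[c cn]|no_c] := pselect (exists c : int, choice.pickle c = n); last first.
  rewrite (_ : _ `&` _ = set0) ?measure0; last first.
    by rewrite -subset0 => w [_ /= Dw]; apply: no_c; exists (a 0%N w).
  by rewrite mule_ge0 ?lee_fin //; apply: integral_ge0 => w _; rewrite lee_fin.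
have Dc : D n = [set w | a 0%N w = c].
  rewrite /D -cn; apply/seteqP; split => w /=; last by move->.
  exact: (pcan_inj choice.pickleK).
have -> : \int[Pr]_(w in D n) ((tau (a 0%N w))%:R * (a 0%N w != 0)%:R)%:E = (X c)%:E * Pr (D n).
  rewrite -integral_cst //; apply: eq_integral => w.
  by rewrite inE Dc /= => ->.
have [c0|c_neq0] := eqVneq c 0%R.
  rewrite (_ : _ `&` _ = set0) ?measure0; last first.
    by rewrite -subset0 Dc c0 => w [[/= a0 _] /a0].
  by rewrite mule_ge0 ?lee_fin // mule_ge0 ?lee_fin.
have := reducible_prob_le rp c_neq0; rewrite -/K muleA -EFinM /X c_neq0 mulr1 Dc.
apply: le_trans; rewrite (_ : _ `&` _ =
  [set w | a 0%N w = c /\ ~ irreducibleZ (monic_of d (fun j => a j w))]) //.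
apply/seteqP; split => w /=; first by case=> [[_ ?] ?].
by case=> ac red; split => //; split => //; rewrite ac; apply/eqP.
Qed.

(** The space is covered by three events: irreducible, zero constant coefficient, and reducible with
    nonzero constant coefficient. *)
Lemma irreducible_prob_ge (R : realType) (d m L H : nat) (C : R) (disp : measure_display)
    (Omega : measurableType disp) (Pr : probability Omega R)
    (t : 'I_m -> {RV Pr >-> R}) (a : nat -> {RV Pr >-> int}) :
  random_poly d L H C t a ->
  1 - Pr [set w | a 0%N w = 0%R]
    - (2 * C * d%:R * m%:R * 2 ^+ d * L%:R / H%:R)%R%:E
      * 'E_Pr[(fun w => (tau (a 0%N w))%:R * (a 0%N w != 0)%:R)%R]
  <= Pr [set w | irreducibleZ (monic_of d (fun j => a j w))].
Proof.
move=> rp; have := reducible_expectation_le rp.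
set B := [set w | _ /\ _]; set I := [set w | irreducibleZ _]; set Z := [set w | _ = 0%R].
move: (_ * 'E_Pr[_]) => y le_y.
have mI : measurable I by apply: measurable_irreducible.
have mZ : measurable Z by exact: (measurable_int_preimage (a 0%N) [set 0%R]).
have mB : measurable B.
  apply: measurableI; last exact: measurableC.
  exact: (measurable_int_preimage (a 0%N) [set c | c <> 0%R]).
have cover : 1 <= Pr I + Pr Z + Pr B.
  rewrite -(@probability_setT _ _ _ Pr).
  apply: (@le_trans _ _ (Pr ((I `|` Z) `|` B))); last first.
    apply: le_trans (measureU2 _ _ _) _ => //; first exact: measurableU.
    by apply: leeD2r; apply: measureU2.
  apply: le_measure; rewrite ?inE //; first by apply: measurableU => //; apply: measurableU.
  move=> w _; have [Iw|nIw] := pselect (I w); first by left; left.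
  by have [Zw|nZw] := pselect (Z w); [left; right|right].
(* For [y = +oo] the lower bound is [-oo]; [y = -oo] is excluded because [y] dominates a
   probability. *)
case: y le_y => [y| |] le_y; last 2 first.
- by rewrite addeNy leNye.
- by have := le_trans (measure_ge0 Pr B) le_y.
move: cover le_y; rewrite -(fineK (fin_num_measure Pr I mI)) -(fineK (fin_num_measure Pr Z mZ)).
rewrite -(fineK (fin_num_measure Pr B mB)) -!EFinD !lee_fin; lra.
Qed.

Lemma irreducible_prob_ge_real (R : realType) (d m L H : nat) (C : R) (disp : measure_display)
    (Omega : measurableType disp) (Pr : probability Omega R)
    (t : 'I_m -> {RV Pr >-> R}) (a : nat -> {RV Pr >-> int}) (z e : R) :
  random_poly d L H C t a ->
  Pr [set w | a 0%N w = 0%R] <= z%:E ->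
  'E_Pr[(fun w => (tau (a 0%N w))%:R * (a 0%N w != 0)%:R)%R] <= e%:E ->
  (1 - z - 2 * C * m%:R * d%:R * 2 ^+ d * L%:R * e / H%:R)%R%:E
  <= Pr [set w | irreducibleZ (monic_of d (fun j => a j w))].
Proof.
move=> rp le_z le_e; apply: le_trans (irreducible_prob_ge rp).
have -> : (2 * C * m%:R * d%:R * 2 ^+ d * L%:R * e / H%:R =
  2 * C * d%:R * m%:R * 2 ^+ d * L%:R / H%:R * e)%R by ring.
rewrite !EFinB EFinM; apply: leeB; first exact: leeB.
apply: lee_wpmul2l => //; rewrite lee_fin divr_ge0 ?mulr_ge0 ?exprn_ge0 // ltW //.
exact: rp_C rp.
Qed.

(** * Particular laws of the constant coefficient *)

Lemma distribution1_ae (R : realType) (disp : measure_display)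
    (Omega : measurableType disp) (Pr : probability Omega R) (X : {RV Pr >-> int}) (A : set int) :
  distribution Pr X A = 1 -> {ae Pr, forall w, A (X w)}.
Proof.
move=> A1; exists (~` (X @^-1` A)); split => //.
  by apply: measurableC; apply: measurable_int_preimage.
rewrite probability_setC; last exact: measurable_int_preimage.
by rewrite [X in 1 - X]A1 subee.
Qed.

Lemma expectation_int_le (R : realType) (disp : measure_display)
    (Omega : measurableType disp) (Pr : probability Omega R) (X : {RV Pr >-> int})
    (f : int -> R) (s : seq int) :
  (forall c, 0 <= f c)%R -> uniq s -> {ae Pr, forall w, X w \in s} ->
  'E_Pr[(fun w => f (X w))] <= \sum_(v <- s) (f v)%:E * Pr [set w | X w = v].
Proof.
move=> f_ge0 uniq_s Xs; rewrite unlock.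
have mD v : measurable [set w | X w = v] by exact: (measurable_int_preimage X [set v]).
pose g (v : int) w : \bar R := (f v)%:E * (\1_[set w | X w = v] w)%:E.
have g_ge0 v w : 0 <= g v w by rewrite mule_ge0 // lee_fin.
have gE v w : g v w = if X w == v then (f v)%:E else 0.
  rewrite /g indicE; case: eqP => Xv; first by rewrite mem_set // mule1.
  by rewrite memNset // mule0.
have mg v : measurable_fun setT (g v).
  move=> _ Y mY; rewrite setTI.
  rewrite (_ : _ @^-1` _ = X @^-1` [set c | Y (if c == v then (f v)%:E else 0)]).
    exact: measurable_int_preimage.
  by apply/seteqP; split => w /=; rewrite gE.
have -> : \sum_(v <- s) (f v)%:E * Pr [set w | X w = v] = \int[Pr]_w (\sum_(v <- s) g v w).
  rewrite ge0_integral_sum //; apply: eq_bigr => v _.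
  rewrite ge0_integralZl_EFin //; last exact/measurable_EFinP/measurable_indic.
  by rewrite integral_indic // setIT.
apply: ae_ge0_le_integral => //.
- by move=> w _; rewrite lee_fin.
- by move=> _ Y mY; rewrite setTI; exact: (measurable_int_preimage X [set c | Y (f c)%:E]).
- by move=> w _; apply: sume_ge0.
- exact: emeasurable_sum.
move: Xs; apply: filterS => w Xs _.
by rewrite (bigD1_seq (X w)) //= gE eqxx leeDl // sume_ge0.
Qed.

(** Simple integers are positive, so the constant coefficient is almost surely nonzero, and the
    expectation of its number of divisors is at most [s]. *)
Lemma irreducible_prob_ge_simple (R : realType) (s d m L H : nat) (C : R) (disp : measure_display)
    (Omega : measurableType disp) (Pr : probability Omega R)
    (t : 'I_m -> {RV Pr >-> R}) (a : nat -> {RV Pr >-> int}) :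
  random_poly d L H C t a ->
  distribution Pr (a 0%N) [set n | simple s n] = 1 ->
  (1 - 2 * C * m%:R * d%:R * 2 ^+ d * L%:R * s%:R / H%:R)%R%:E
  <= Pr [set w | irreducibleZ (monic_of d (fun j => a j w))].
Proof.
move=> rp /distribution1_ae a0_simple.
rewrite -[X in (X - _)%R](subr0 1%R); apply: irreducible_prob_ge_real rp _ _.
  have -> : 0%:E = Pr set0 by rewrite measure0.
  apply: ae_le_measure => //.
    exact: (measurable_int_preimage (a 0%N) [set 0%R]).
  by move: a0_simple; apply: filterS => w [+ _] /= a0; rewrite a0 ltxx.
rewrite unlock; apply: (@le_trans _ _ (\int[Pr]_(w in setT) cst s%:R%:E w)); last first.
  by rewrite integral_cst // -[leRHS]mule1 lee_wpmul2l ?probability_le1 ?lee_fin.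
apply: ae_ge0_le_integral => //.
- move=> _ Y mY; rewrite setTI.
  exact: (measurable_int_preimage (a 0%N) [set c | Y ((tau c)%:R * (c != 0)%:R)%R%:E]).
- by move=> w _; rewrite lee_fin.
move: a0_simple; apply: filterS => w [_ le_s] _.
rewrite lee_fin -natrM ler_nat (leq_trans _ le_s) // -[leqRHS]muln1 leq_mul2l.
by rewrite leq_b1 orbT.
Qed.

(** Both readings of uniformity are dominated by the law weighted by multiplicity, up to the factor
    of [size_values_le]. *)
Lemma uniform_values_le (R : realType) (D : set int -> \bar R) (P : {poly int})
    (H : nat) (v : int) :
  uniform_on D (undup (values P H)) \/ uniform_on D (values P H) ->
  D [set v] <= ((maxn 1 (size P).-1 * count_mem v (values P H))%N%:R / (2 * H).+1%:R)%:E.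
Proof.
case=> ->; rewrite lee_fin; last first.
  by rewrite size_values ler_wpM2r ?invr_ge0 // ler_nat leq_pmull // leq_max.
rewrite count_uniq_mem ?undup_uniq // mem_undup.
have [v_P|_] := boolP (v \in values P H); last by rewrite mul0r divr_ge0.
rewrite ler_pdivlMr ?ltr0n // mulrAC ler_pdivrMr; last first.
  by rewrite ltr0n -has_predT; apply/hasP; exists v; rewrite ?mem_undup.
by rewrite mul1r -natrM ler_nat size_values_le.
Qed.

(** A nonzero constant never takes the value 0. Otherwise every value has multiplicity at most deg
    P, which bounds the weight of 0 when multiplicities count and bounds the number of distinct
    values from below when they do not. *)
Lemma uniform_values_0 (R : realType) (D : set int -> \bar R) (P : {poly int}) (H : nat) :
  P != 0%R -> uniform_on D (undup (values P H)) \/ uniform_on D (values P H) ->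
  D [set 0%R] <= ((size P).-1%:R / (2 * H + 1)%:R)%:E.
Proof.
move=> P_neq0 unif; have le_count : (count_mem 0%R (values P H) <= (size P).-1)%N.
  by apply: count_values_le; rewrite polyC0.
rewrite addn1; have [P_const|P_nconst] := leqP (size P) 1.
  apply: le_trans (uniform_values_le 0%R unif) _.
  have /eqP -> : (count_mem 0%R (values P H) == 0)%N.
    by rewrite -leqn0 (leq_trans le_count) // -subn1 leq_subLR addn0.
  by rewrite muln0 mul0r lee_fin divr_ge0.
case: unif => ->; rewrite lee_fin; last first.
  by rewrite size_values ler_wpM2r ?invr_ge0 // ler_nat.
rewrite count_uniq_mem ?undup_uniq // mem_undup.
have [v_P|_] := boolP (0%R \in values P H); last by rewrite mul0r divr_ge0.
have undup_gt0 : (0 < size (undup (values P H)))%N.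
  by rewrite -has_predT; apply/hasP; exists 0%R; rewrite ?mem_undup.
rewrite ler_pdivlMr ?ltr0n // mulrAC ler_pdivrMr ?ltr0n //.
rewrite mul1r -natrM ler_nat -(size_values P H) -(sum_count_undup (values P H)).
apply: (@leq_trans (\sum_(x <- undup (values P H)) (size P).-1)%N).
  apply: leq_sum => x _; apply: count_values_le.
  by apply: contraTneq P_nconst => ->; rewrite -leqNgt size_polyC_leq1.
by rewrite big_const_seq count_predT iter_addn_0.
Qed.

Lemma uniform_on_ae (R : realType) (disp : measure_display)
    (Omega : measurableType disp) (Pr : probability Omega R) (X : {RV Pr >-> int}) (s : seq int) :
  (0 < size s)%N -> uniform_on (distribution Pr X) s -> {ae Pr, forall w, X w \in s}.
Proof.
move=> s_gt0 unif; apply: (@distribution1_ae _ _ _ Pr X [set` s]).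
have -> : [set` s] = \bigcup_(v in [set` undup s]) [set v].
  apply/seteqP; split => [x /= xs|x [y /= ys ->]]; last by rewrite mem_undup in ys.
  by exists x => //=; rewrite mem_undup.
rewrite /distribution /pushforward preimage_bigcup measure_fin_bigcup //.
- rewrite -fsbig_seq ?undup_uniq //.
  rewrite (eq_bigr (fun v => ((count_mem v s)%:R / (size s)%:R)%:E)) => [|v _]; last exact: unif.
  rewrite sumEFin -mulr_suml -natr_sum sum_count_undup divff //.
  by rewrite pnatr_eq0 -lt0n.
- exact: finite_seq.
- apply/trivIsetP => x y _ _ /eqP xy; apply/seteqP; split => // w [Dx Dy].
  by case: xy; rewrite -Dx -Dy.
- by move=> v _; apply: measurable_int_preimage.
Qed.

(** The expectation is at most [g / (2 * H + 1)] times the sum of the numbers of divisors over the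
    nonzero values, itself at most [H] times a power of log H. The factor [g], which depends on [P]
    only, goes into the exponent. *)
Lemma irreducible_prob_ge_values (R : realType) (P : {poly int}) : P != 0%R ->
  exists CP : R,
  forall (d m L H : nat) (C : R) (disp : measure_display)
    (Omega : measurableType disp) (Pr : probability Omega R)
    (t : 'I_m -> {RV Pr >-> R}) (a : nat -> {RV Pr >-> int}),
  random_poly d L H C t a -> (3 <= H)%N ->
  uniform_on (distribution Pr (a 0%N)) (undup (values P H)) \/
    uniform_on (distribution Pr (a 0%N)) (values P H) ->
  (1 - (size P).-1%:R / (2 * H + 1)%:R
     - 2 * C * m%:R * d%:R * 2 ^+ d * L%:R * (ln H%:R `^ CP) / H%:R)%R%:E
  <= Pr [set w | irreducibleZ (monic_of d (fun j => a j w))].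
Proof.
move=> P_neq0; have [C1 le_tau] := sum_tau_power_le R 1 P_neq0.
pose g := maxn 1 (size P).-1; have [e le_e] := exprn_absorb (g%:R : R).
exists (e + C1)%:R => d m L H C disp Omega Pr t a rp H_ge3 unif.
have lnH := ln_gt1 R H_ge3.
have lnH_ge0 : (0 <= ln H%:R :> R)%R by rewrite ltW // (lt_trans ltr01).
rewrite powR_mulrn //; apply: irreducible_prob_ge_real rp _ _.
  exact: uniform_values_0 P_neq0 unif.
pose f (c : int) : R := ((tau c)%:R * (c != 0)%:R)%R.
have a0_ae : {ae Pr, forall w, a 0%N w \in undup (values P H)}.
  case: unif => /uniform_on_ae unif_ae.
    apply: unif_ae; rewrite lt0n; apply/eqP => /size0nil/undup_nil v0.
    by have := size_values P H; rewrite v0.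
  have : {ae Pr, forall w, a 0%N w \in values P H} by apply: unif_ae; rewrite size_values.
  by apply: filterS => w; rewrite mem_undup.
apply: le_trans (expectation_int_le (f := f) _ (undup_uniq _) a0_ae) _.
  by move=> c; rewrite mulr_ge0.
apply: (@le_trans _ _ (\sum_(v <- undup (values P H))
    (f v *+ count_mem v (values P H) * (g%:R / (2 * H).+1%:R))%R%:E)).
  apply: lee_sum => v _.
  apply: (@le_trans _ _ ((f v)%:E * ((g * count_mem v (values P H))%N%:R / (2 * H).+1%:R)%R%:E)).
    by apply: lee_wpmul2l; [rewrite lee_fin mulr_ge0 | exact: uniform_values_le unif].
  by rewrite -EFinM lee_fin natrM -mulr_natr; rewrite le_eqVlt; apply/orP; left; apply/eqP; ring.
rewrite sumEFin lee_fin -mulr_suml sum_undup_count /values big_map.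
have -> : (\sum_(n <- iota 0 (2 * H).+1) f P.[n%:Z - H%:Z] =
    \sum_(0 <= n < (2 * H).+1 | P.[n%:Z - H%:Z] != 0) (tau P.[n%:Z - H%:Z])%:R ^+ 1)%R.
  rewrite /index_iota subn0 [RHS]big_mkcond; apply: eq_bigr => n _.
  by rewrite /f expr1; case: eqP => _; rewrite ?mulr1 ?mulr0.
apply: (@le_trans _ _ (H%:R * ln H%:R ^+ C1 * (g%:R / (2 * H).+1%:R))%R).
  by rewrite ler_wpM2r ?divr_ge0 // le_tau.
have ln3_le : (ln 3 <= ln H%:R :> R)%R.
  by rewrite ler_ln ?posrE ?ltr0n ?ler_nat // (leq_trans _ H_ge3).
have -> : (H%:R * ln H%:R ^+ C1 * (g%:R / (2 * H).+1%:R) =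
    g%:R * ln H%:R ^+ C1 * (H%:R / (2 * H).+1%:R) :> R)%R by ring.
rewrite exprD -[leRHS]mulr1; apply: ler_pM.
- by rewrite mulr_ge0 ?exprn_ge0.
- by rewrite divr_ge0.
- by rewrite ler_wpM2r ?exprn_ge0 // le_e.
by rewrite ler_pdivrMr ?ltr0n // mul1r ler_nat -addn1 mul2n -addnn -addnA leq_addr.
Qed.

End Probability.

(** * The general bound and its two special cases *)

Local Open Scope classical_set_scope.
Local Open Scope ring_scope.
Local Open Scope ereal_scope.

Theorem theorem1p5 (R : realType) :
  (forall (d m L H : nat) (C : R) (disp : measure_display)
      (Omega : measurableType disp) (Pr : probability Omega R)
      (t : 'I_m -> {RV Pr >-> R}) (a : nat -> {RV Pr >-> int}),
    random_poly d L H C t a ->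
    1 - Pr [set w | a 0%N w = 0%R]
      - (2 * C * d%:R * m%:R * 2 ^+ d * L%:R / H%:R)%R%:E
        * 'E_Pr[(fun w => (tau (a 0%N w))%:R * (a 0%N w != 0)%:R)%R]
    <= Pr [set w | irreducibleZ (monic_of d (fun j => a j w))])
  /\
  (forall P : {poly int}, P != 0%R -> exists CP : R,
    forall (d m L H : nat) (C : R) (disp : measure_display)
      (Omega : measurableType disp) (Pr : probability Omega R)
      (t : 'I_m -> {RV Pr >-> R}) (a : nat -> {RV Pr >-> int}),
    random_poly d L H C t a ->
    (3 <= H)%N ->
    uniform_on (distribution Pr (a 0%N)) (undup (values P H)) \/
      uniform_on (distribution Pr (a 0%N)) (values P H) ->
    (1 - (size P).-1%:R / (2 * H + 1)%:R
       - 2 * C * m%:R * d%:R * 2 ^+ d * L%:R * (ln H%:R `^ CP) / H%:R)%R%:E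
    <= Pr [set w | irreducibleZ (monic_of d (fun j => a j w))])
  /\
  (forall (s d m L H : nat) (C : R) (disp : measure_display)
      (Omega : measurableType disp) (Pr : probability Omega R)
      (t : 'I_m -> {RV Pr >-> R}) (a : nat -> {RV Pr >-> int}),
    random_poly d L H C t a ->
    distribution Pr (a 0%N) [set n | simple s n] = 1 ->
    (1 - 2 * C * m%:R * d%:R * 2 ^+ d * L%:R * s%:R / H%:R)%R%:E
    <= Pr [set w | irreducibleZ (monic_of d (fun j => a j w))]).
Proof.
split=> [d m L H C disp Omega Pr t a|]; first exact: irreducible_prob_ge.
split=> [P|s d m L H C disp Omega Pr t a]; first exact: irreducible_prob_ge_values.
exact: irreducible_prob_ge_simple.
Qed.
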